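(* Let $N\ge 2$ and $0<s<\frac12$, and put $r(s)=\frac{s}{1-s}$. Let $\{t_n\}_{n=1}^\infty$ be a decreasing sequence converging to zero with $\{t_n\}_{n=1}^\infty\in\ell^{r(s),\infty}(\mathbb{N})$. Then there is a constant $C$, not depending on $f$, such that $$\Bigl\|\sup_{n\in\mathbb{N}}|e^{it_nL}f|\Bigr\|_{L^2(B(0,1))}\le C\|f\|_{H^s(\mathbb{R}^N)}\qquad\text{for all } f\in H^s(\mathbb{R}^N).$$
   Context: For $t\in\mathbb{R}$, $e^{itL}f(x)=\int_{\mathbb{R}^N}e^{ix\cdot\xi+it(\xi_1^2-\xi_2^2\pm\cdots\pm\xi_N^2)}\hat f(\xi)\,d\xi$, for any fixed choice of the signs $\pm$ of $\xi_3^2,\dots,\xi_N^2$, with $\hat f$ the Fourier transform of $f$ (normalized so that $t=0$ gives $f$; for $f\in L^2$ the integral is understood as the usual $L^2$ extension). $B(0,1)$ is the unit ball of $\mathbb{R}^N$ centered at the origin. $H^s(\mathbb{R}^N)$ is the usual inhomogeneous $L^2$-based Sobolev space. For $0<r<\infty$, a sequence $\{t_n\}$ belongs to $\ell^{r,\infty}(\mathbb{N})$ if $\sup_{b>0}b^r\,\sharp\{n\in\mathbb{N}:t_n>b\}<\infty$, where $\sharp$ denotes cardinality. *)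

(* Defs.v *)
From HB Require Import structures.
From mathcomp Require Import all_boot all_order all_algebra.
From mathcomp Require Import all_classical all_reals all_analysis.
From mathcomp Require Import complex.

Set Implicit Arguments.
Unset Strict Implicit.
Unset Printing Implicit Defensive.

Import Order.TTheory GRing.Theory Num.Theory.
Import numFieldNormedType.Exports.
Import ComplexField.Normc.

Local Open Scope classical_set_scope.
Local Open Scope ring_scope.
Local Open Scope complex_scope.

(* [measurableTypeR R] is [R] with its Borel sigma-algebra, so that the
   sigma-algebra of [Rn R N] is the Borel one.  Coordinates are 0-based:
   [tnth x i] is the coordinate usually written x_{i+1}. *)
Notation Rn R N := (N.-tuple (measurableTypeR R)).

Section lebesgue.
Variable R : realType.

Definition tuple_of_pair (n : nat) (p : Rn R n * measurableTypeR R) :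
    Rn R n.+1 := [tuple of p.2 :: p.1].

Lemma measurable_tuple_of_pair n :
  measurable_fun [set: Rn R n * measurableTypeR R] (@tuple_of_pair n).
Proof. exact: measurable_cons. Qed.

(* The Lebesgue measure on R^(n+1) is the image under [tuple_of_pair] of the
   product of the ones on R^n and on R.  The right-hand side below is
   [pushforward _ (@tuple_of_pair n)] packed as a measure. *)
Definition lebesgue_step (n : nat) (m : {measure set (Rn R n) -> \bar R}) :
    {measure set (Rn R n.+1) -> \bar R} :=
  let prod : {measure set (Rn R n * measurableTypeR R) -> \bar R} :=
    (m \x (@lebesgue_measure R))%E in
  measure_function_pushforward__canonical__measure_function_Measure prod
    (@measurable_tuple_of_pair n).

Fixpoint lebesgue (n : nat) : {measure set (Rn R n) -> \bar R} :=
  match n with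
  | 0 => @dirac _ (Rn R 0) [tuple] R
  | n'.+1 => lebesgue_step (lebesgue n')
  end.

Lemma measurable_box n (A : 'I_n -> set (measurableTypeR R)) :
  (forall i, measurable (A i)) ->
  measurable [set x : Rn R n | forall i, A i (tnth x i)].
Proof.
move=> mA.
rewrite (_ : [set x | _] =
    \bigcap_(i in [set: 'I_n]) ((fun x : Rn R n => tnth x i) @^-1` A i)).
  apply: fin_bigcap_measurable => // i _; rewrite -[X in measurable X]setTI.
  exact: measurable_tnth.
by apply/seteqP; split=> x /= h i; [move=> _|]; exact: h.
Qed.

Lemma lebesgue_box n (A : 'I_n -> set (measurableTypeR R)) :
  (forall i, measurable (A i)) ->
  lebesgue n [set x | forall i, A i (tnth x i)] =
  (\prod_(i < n) lebesgue_measure (A i))%E.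
Proof.
elim: n A => [|n IH] A mA.
  by rewrite big_ord0 /= /dirac indicE mem_set//= => -[].
pose B i := A (lift ord0 i).
rewrite big_ord_recl /= /pushforward.
rewrite (_ : _ @^-1` _ = [set x | forall i, B i (tnth x i)] `*` A ord0).
  rewrite product_measure1E//; last first.
    by apply: measurable_box => i; exact: mA.
  by rewrite IH 1?muleC// => i; exact: mA.
apply/seteqP; split=> -[y x] /=.
  move=> h; split; last exact: (h ord0).
  by move=> i; move: (h (lift ord0 i)); rewrite tnthS.
move=> [h h0] i; have [j ->|->] := unliftP ord0 i; last exact: h0.
by rewrite tnthS; exact: h.
Qed.

End lebesgue.

Section spaces.
Variables (R : realType) (N : nat).
Implicit Types (x xi : Rn R N) (f g : Rn R N -> R[i]).

Definition dotp x xi : R := \sum_(i < N) tnth x i * tnth xi i.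

Definition unit_ball : set (Rn R N) := [set x | Num.sqrt (dotp x x) < 1].

Definition cmeasurable f :=
  measurable_fun setT (fun x => complex.Re (f x)) /\
  measurable_fun setT (fun x => complex.Im (f x)).

(* Square-integrability is imposed on Borel functions: a.e. classes are
   represented by their Borel members. *)
Definition normL (p : R) f : \bar R :=
  Lnorm (lebesgue R N) p%:E (fun x => (normc (f x))%:E).

Definition inL (p : R) f := cmeasurable f /\ (normL p f < +oo)%E.

Definition cintegral f : R[i] :=
  Rintegral (lebesgue R N) setT (fun x => complex.Re (f x)) +i*
  Rintegral (lebesgue R N) setT (fun x => complex.Im (f x)).

Definition cis (a : R) : R[i] := cos a +i* sin a.

(* Extension to L^2, by L^2-continuity, of an operator [T] given by an integral
   on L^1 `&` L^2.  When [T] is a multiple of an L^2-isometry (Plancherel), as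
   it is in all the uses below, each f in L^2 has exactly one image up to a.e.
   equality; [L2extension T f] is a version of it. *)
Definition is_L2extension (T : (Rn R N -> R[i]) -> Rn R N -> R[i]) f g :=
  [/\ inL 2 f, inL 2 g &
   exists h : nat -> Rn R N -> R[i],
    [/\ forall k, inL 1 (h k) /\ inL 2 (h k),
        normL 2 (fun x => h k x - f x) @[k --> \oo] --> 0%E &
        normL 2 (fun x => T (h k) x - g x) @[k --> \oo] --> 0%E]].

Definition L2extension (T : (Rn R N -> R[i]) -> Rn R N -> R[i]) f :
    Rn R N -> R[i] :=
  xget (fun=> 0) [set g | is_L2extension T f g].

(* The factor (2 pi)^-N sits on the direct transform because the propagator
   carries none. *)
Definition fourier_integral f xi : R[i] :=
  ((2 * pi) ^- N)%:C * cintegral (fun x => cis (- dotp x xi) * f x).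

Definition fourier f : Rn R N -> R[i] := L2extension fourier_integral f.

(* The coefficient of xi_1^2 is +1, that of xi_2^2 is -1; the later ones are
   (-1)^(eps i), with [eps] arbitrary. *)
Definition symbol_sign (eps : 'I_N -> bool) (i : 'I_N) : bool :=
  match val i with 0 => false | 1 => true | _ => eps i end.

Definition symbol (eps : 'I_N -> bool) xi : R :=
  \sum_(i < N) (-1) ^+ symbol_sign eps i * tnth xi i ^+ 2.

Definition oscillatory_integral (eps : 'I_N -> bool) (t : R) g x : R[i] :=
  cintegral (fun xi => cis (dotp x xi + t * symbol eps xi) * g xi).

Definition propagator (eps : 'I_N -> bool) (t : R) f : Rn R N -> R[i] :=
  L2extension (oscillatory_integral eps t) (fourier f).

Definition sobolev_norm (s : R) f : \bar R :=
  normL 2 (fun xi => ((1 + dotp xi xi) `^ (s / 2))%:C * fourier f xi).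

(* For s >= 0, H^s is a subspace of L^2. *)
Definition in_sobolev (s : R) f := inL 2 f /\ (sobolev_norm s f < +oo)%E.

End spaces.

(* [counting A] is the cardinality of [A], +oo when [A] is infinite. *)
Definition in_weak_lr (R : realType) (r : R) (t : nat -> R) :=
  (ereal_sup [set ((b `^ r)%R%:E * counting [set n | (b < t n)%R])%E
             | b in [set b : R | (0 < b)%R]] < +oo)%E.

Definition maximal_function (R : realType) (T : Type) (u : nat -> T -> R[i])
    (x : T) : \bar R :=
  ereal_sup [set (normc (u n x))%:E | n in [set: nat]].

(* Main.v *)
(** Write [rho = 1 + |xi|^2], and let [T_t] be the operator with symbol
    [cis (t * sigma xi)], [|sigma| <= |xi|^2].  Only the local bound
    [int_B |T_t phi|^2 <= A int |phi|^2] is needed, and it has an elementary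
    proof: for a compactly supported product weight [w >= 1] on [B], the Gram
    kernel [int w(x) cis (x . (xi - eta)) dx] is dominated by a product of
    Cauchy kernels, so Schur's test applies.  Together with the triangle
    inequality this also replaces Plancherel in the passage to the [L^2] extensions.

    For the maximal function let [a = 2^-(1-s)] and assign to [t_n > 0] the
    least [K] with [a^K <= t_n].  On the frequencies [rho >= 2^K] the supremum
    is bounded by the square function: by the weak [l^r] hypothesis
    [#{n : t_n >= rho^-(1-s)} <= C rho^s].  On a dyadic shell
    [2^k <= rho < 2^(k+1)] with [k < K] one compares [T_t] with [T_0] by
    chaining along the dyadic times; all times in [[0, b]] cost [b 2^k].
    For [b = a^(K-1)], summing over the shells with weights [(4/3)^(K-k)] and
    then over [K > k] gives [2^(ks)], since [4a/3 < 1] for [s < 1/2]. *)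
From HB Require Import structures.
Require Import Defs.
From mathcomp Require Import all_boot all_order all_algebra.
From mathcomp Require Import all_classical all_reals all_analysis.
From mathcomp Require Import measurable_realfun complex.
From mathcomp Require Import ring lra.

Set Implicit Arguments.
Unset Strict Implicit.
Unset Printing Implicit Defensive.

Import Order.TTheory GRing.Theory Num.Theory.
Import numFieldNormedType.Exports.

Local Open Scope classical_set_scope.
Local Open Scope ring_scope.

(** The threshold [rho^-(1-s)] balances two costs, neither of which may exceed [rho^s], the weight
    in the Sobolev norm. At frequency [rho], the times above the threshold are paid for one by one;
    since [r (1-s) = s], the weak hypothesis allows [C rho^s] of them. The times below it may be
    infinitely many, but they lie in an interval of length [b = rho^-(1-s)], and covering it by
    steps [1/rho], across which the phase changes by a bounded amount, costs [b rho = rho^s] again.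

    A supremum is not linear in the data, so the shells below the scale of a time cannot be
    recombined by orthogonality. A weighted inequality for [|z + w|^2] takes its place, at the price
    of a geometric factor per shell.

    Only finitely many times are treated at once, with constants that do not depend on their number.
    Every supremum is then dominated by a finite sum of squares, chains have finite length, and
    neither continuity in [t] nor measurability of an uncountable supremum has to be discussed. *)

Section integral_operators.
Context d1 d2 (X : measurableType d1) (Y : measurableType d2) (R : realType).
Local Open Scope ereal_scope.

Lemma integrable_boundedM (m : {measure set Y -> \bar R}) (g h : Y -> R) (M : R) :
  measurable_fun setT g -> (forall y, `|g y| <= M)%R ->
  m.-integrable setT (EFin \o h) ->
  m.-integrable setT (fun y => (g y * h y)%:E).
Proof.
move=> mg gM ih; have M0 : (0 <= M)%R by apply: le_trans (gM point).
have mh : measurable_fun setT h by apply/measurable_EFinP/measurable_int/ih.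
apply: le_integrable (integrableZl measurableT M ih) => //.
  exact/measurable_EFinP/measurable_funM.
move=> y _ /=; rewrite lee_fin !normrM ler_wpM2r//.
by rewrite (ger0_norm M0).
Qed.

(** No integrability is assumed: the integral is the difference of those of the positive and
    negative parts, and Tonelli makes each of them measurable. *)
Lemma measurable_fun_integral_snd (m : {sigma_finite_measure set Y -> \bar R})
    (f : X * Y -> \bar R) : measurable_fun setT f ->
  measurable_fun setT (fun x => \int[m]_y f (x, y)).
Proof.
move=> mf; rewrite (_ : (fun x => _) =
    fun x => \int[m]_y f^\+ (x, y) - \int[m]_y f^\- (x, y)).
  apply: emeasurable_funB.
    by apply: (measurable_fun_fubini_tonelli_F (f^\+)) => //; exact: measurable_funepos.
  by apply: (measurable_fun_fubini_tonelli_F (f^\-)) => //; exact: measurable_funeneg.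
by apply/funext => x; rewrite integralE; congr (_ - _); apply: eq_integral => y _; rewrite ?funeposE ?funenegE.
Qed.

Lemma measurable_fun_Rintegral_snd (m : {sigma_finite_measure set Y -> \bar R})
    (f : X * Y -> R) : measurable_fun setT f ->
  measurable_fun setT (fun x => \int[m]_y f (x, y))%R.
Proof.
move=> mf; apply: (measurableT_comp (f := @fine R)) => //.
by apply: (measurable_fun_integral_snd _ (f := EFin \o f)); exact/measurable_EFinP.
Qed.

Lemma measurable_fun_Rintegral_fst (m : {sigma_finite_measure set X -> \bar R})
    (f : X * Y -> R) : measurable_fun setT f ->
  measurable_fun setT (fun y => \int[m]_x f (x, y))%R.
Proof.
move=> mf; apply: (measurableT_comp (f := @fine R)) => //.
rewrite (_ : (fun y => _) =
    fun y => \int[m]_x (EFin \o f)^\+ (x, y) - \int[m]_x (EFin \o f)^\- (x, y)).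
  have mf' : measurable_fun setT (EFin \o f) by exact/measurable_EFinP.
  apply: emeasurable_funB.
    by apply: (measurable_fun_fubini_tonelli_G ((EFin \o f)^\+)) => //; exact: measurable_funepos.
  by apply: (measurable_fun_fubini_tonelli_G ((EFin \o f)^\-)) => //; exact: measurable_funeneg.
by apply/funext => x; rewrite integralE; congr (_ - _);
  apply: eq_integral => y _; rewrite ?funeposE ?funenegE.
Qed.

(** Integrability is not assumed here either: when the extended integral is infinite, [fine] turns
    the left-hand side into 0. *)
Lemma normr_Rintegral_le (m : {measure set Y -> \bar R}) (f : Y -> R) :
  measurable_fun setT f ->
  (`|\int[m]_y f y|%R)%:E <= \int[m]_y `|f y|%:E.
Proof.
move=> mf; have ef : measurable_fun setT (EFin \o f) by exact/measurable_EFinP.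
apply: le_trans (le_abse_integral m measurableT ef).
rewrite /Rintegral; case: (\int[m]_y (f y)%:E) => [r||] //=.
  by rewrite normr0 leey.
by rewrite normr0 leey.
Qed.

End integral_operators.

(** * A Schur test for [T T^*] *)

Section schur_test.
Context d1 d2 (X : measurableType d1) (Y : measurableType d2) (R : realType).
Variables (mX : {sigma_finite_measure set X -> \bar R}).
Variables (mY : {sigma_finite_measure set Y -> \bar R}).
Variables (w : X -> R) (c : X * Y -> R) (k : Y * Y -> R) (A : R).
Hypothesis w0 : forall x, 0 <= w x.
Hypothesis iw : mX.-integrable setT (EFin \o w).
Hypothesis mc : measurable_fun setT c.
Hypothesis c1 : forall z, `|c z| <= 1.
Hypothesis mk : measurable_fun setT k.
Hypothesis k0 : forall z, 0 <= k z.
Hypothesis gram : forall y y',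
  (`|\int[mX]_x (w x * (c (x, y) * c (x, y')))%:E| <= (k (y, y'))%:E)%E.
Hypothesis kl : forall y, (\int[mY]_y' (k (y, y'))%:E <= A%:E)%E.
Hypothesis kr : forall y', (\int[mY]_y (k (y, y'))%:E <= A%:E)%E.
Local Open Scope ereal_scope.

Let mw : measurable_fun setT w.
Proof. exact/measurable_EFinP/measurable_int/iw. Qed.

Let mcx x : measurable_fun setT (fun y => c (x, y)).
Proof. exact: measurableT_comp. Qed.

Let mcy y : measurable_fun setT (fun x => c (x, y)).
Proof. exact: measurableT_comp. Qed.

Let A0 : (0 <= A)%R.
Proof. by rewrite -lee_fin; apply: le_trans (kl point); apply: integral_ge0 => y _; rewrite lee_fin. Qed.

Variable h : Y -> R.
Hypothesis ih : mY.-integrable setT (EFin \o h).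

Let mh : measurable_fun setT h.
Proof. apply/measurable_EFinP; exact: measurable_int ih. Qed.

Let ich x : mY.-integrable setT (fun y => (c (x, y) * h y)%:E).
Proof. by apply: (@integrable_boundedM _ _ _ _ _ _ 1) => // y. Qed.

Let Ch x : R := (\int[mY]_y (c (x, y) * h y))%R.

Let ChE x : (Ch x)%:E = \int[mY]_y (c (x, y) * h y)%:E.
Proof. by rewrite /Ch fineK//; exact: integrable_fin_num. Qed.

Let mCh : measurable_fun setT Ch.
Proof.
apply/measurable_EFinP; rewrite (_ : _ \o _ = fun x => \int[mY]_y (c (x, y) * h y)%:E).
  apply: (measurable_fun_integral_snd _ (f := fun z => (c z * h z.2)%:E)).
  by apply/measurable_EFinP/measurable_funM => //; exact: measurableT_comp.
by apply/funext => x /=; rewrite ChE.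
Qed.

Let H1 : R := fine (\int[mY]_y `|h y|%:E).

Let H1E : H1%:E = \int[mY]_y `|h y|%:E.
Proof.
by rewrite /H1 fineK//; apply: integrable_fin_num => //; apply: (integrable_abse ih).
Qed.

Let Ch_le x : (`|Ch x| <= H1)%R.
Proof.
rewrite -lee_fin H1E.
have -> : (`|Ch x|)%:E = `| (Ch x)%:E | by [].
rewrite ChE; apply: le_trans (le_abse_integral _ _ _) _ => //.
  by case/integrableP: (ich x).
apply: ge0_le_integral => //.
- by apply: measurableT_comp => //; case/integrableP: (ich x).
- by apply/measurable_EFinP; exact: measurableT_comp.
- by move=> y _; rewrite /= lee_fin normrM ler_piMl.
Qed.

(** The exchange of integrals behind the test. It is used twice: with [g = Ch] it writes the
    quadratic form as a pairing of [h] with [P], and with [g = c (., y)] it writes [P] as the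
    integral operator with the Gram kernel. *)
Let fub (g : X -> R) (M : R) : measurable_fun setT g -> (forall x, `|g x| <= M)%R ->
  \int[mX]_x (w x * g x * Ch x)%:E =
  \int[mY]_y (h y * \int[mX]_x (w x * (g x * c (x, y))))%:E.
Proof.
move=> mg gM; pose f (z : X * Y) : \bar R := (w z.1 * g z.1 * (c z * h z.2))%:E.
have mf : measurable_fun setT f.
  by apply/measurable_EFinP; repeat apply: measurable_funM => //;
    apply: measurableT_comp.
have M0 : (0 <= M)%R by apply: le_trans (gM point).
have if_ : (mX \x mY)%E.-integrable setT f.
  apply/integrable12ltyP => //.
  apply: (@le_lt_trans _ _ (\int[mX]_x (M * H1 * w x)%:E)); last first.
    under eq_integral do rewrite EFinM.
    rewrite integralZl//.
    rewrite lte_mul_pinfty ?lee_fin ?mulr_ge0//.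
      by rewrite -lee_fin H1E integral_ge0// => y _; rewrite lee_fin.
    exact: integrable_lty.
  apply: ge0_le_integral => //.
  - by move=> x _; apply: integral_ge0.
  - have := @measurable_fun_integral_snd _ _ _ _ _ mY (abse \o f).
    by apply; exact: measurableT_comp.
  - by apply/measurable_EFinP; exact: measurable_funM.
  move=> x _; rewrite (_ : M * H1 * w x = w x * M * H1)%R; last by ring.
  rewrite [leRHS]EFinM H1E -ge0_integralZl//=; last 2 first.
    by apply/measurable_EFinP; exact: measurableT_comp.
    by rewrite lee_fin mulr_ge0.
  apply: ge0_le_integral => //.
  - by apply/measurable_EFinP/measurableT_comp => //; do 2 apply: measurable_funM => //.
  - by apply: measurable_funeM; apply/measurable_EFinP; exact: measurableT_comp.
  - move=> y _; rewrite -EFinM lee_fin !normrM (ger0_norm (w0 x)).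
    rewrite -!mulrA; apply: ler_wpM2l => //; apply: ler_pM => //.
    by rewrite ler_piMl.
have := Fubini if_; rewrite /f /=.
under eq_integral => x _.
  under eq_integral do rewrite EFinM.
  rewrite integralZl// -ChE -EFinM; over.
move=> ->; apply: eq_integral => y _.
rewrite EFinM /Rintegral fineK.
  rewrite -integralZl//.
    by apply: eq_integral => x _; rewrite -EFinM; congr EFin; ring.
  rewrite (_ : (fun _ => _) = fun x => (g x * c (x, y) * w x)%:E); last first.
    by apply/funext => x; congr EFin; rewrite mulrC.
  apply: (@integrable_boundedM _ _ _ _ _ _ M) => //; first exact: measurable_funM.
  by move=> x; rewrite normrM -[M]mulr1 ler_pM.
apply: integrable_fin_num => //.
rewrite (_ : (fun _ => _) = fun x => (g x * c (x, y) * w x)%:E); last first.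
  by apply/funext => x; congr EFin; rewrite mulrC.
apply: (@integrable_boundedM _ _ _ _ _ _ M) => //; first exact: measurable_funM.
by move=> x; rewrite normrM -[M]mulr1 ler_pM.
Qed.

(** The left-hand side is the quadratic form of the Gram kernel [G] at [h]. As [|G| <= k], the
    inequality [|h y h y'| <= h y ^ 2 + h y' ^ 2] leaves two terms, bounded by [kl] and, after
    Tonelli, by [kr]; hence [2 A]. *)
Lemma schur_test :
  \int[mX]_x (w x * Ch x ^+ 2)%:E <= (2 * A)%:E * \int[mY]_y (h y ^+ 2)%:E.
Proof.
have -> : \int[mX]_x (w x * Ch x ^+ 2)%:E =
    \int[mY]_y (h y * \int[mX]_x (w x * (Ch x * c (x, y))))%:E.
  rewrite -(fub (g := Ch) (M := H1))//.
  by apply: eq_integral => x _; rewrite expr2 mulrA.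
pose G y y' := (\int[mX]_x (w x * (c (x, y) * c (x, y'))))%R.
pose P y := (\int[mX]_x (w x * (Ch x * c (x, y))))%R.
have PE y : P y = (\int[mY]_y' (h y' * G y y'))%R.
  rewrite /P /Rintegral -(fub (g := fun x => c (x, y)) (M := 1))//.
  by congr fine; apply: eq_integral => x _; congr EFin; ring.
have mP : measurable_fun setT P.
  apply: (measurable_fun_Rintegral_fst _
    (f := fun z => (w z.1 * (Ch z.1 * c z))%R)).
  by repeat apply: measurable_funM => //; apply: measurableT_comp.
have mG y : measurable_fun setT (G y).
  apply: (measurable_fun_Rintegral_fst _
    (f := fun z => (w z.1 * (c (z.1, y) * c z))%R)).
  apply: measurable_funM; first exact: measurableT_comp.
  by apply: measurable_funM => //; apply: (measurableT_comp (mcy y)).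
have mkr y : measurable_fun setT (fun y' => k (y, y')) by exact: measurableT_comp.
have Pk y : (`|P y|)%:E <= \int[mY]_y' (`|h y'| * k (y, y'))%:E.
  rewrite PE; apply: le_trans (normr_Rintegral_le _ _) _.
    exact: measurable_funM.
  apply: ge0_le_integral => //.
  - by apply/measurable_EFinP; apply: measurableT_comp => //; apply: measurable_funM.
  - by apply/measurable_EFinP; apply: measurable_funM => //; apply: measurableT_comp.
  move=> y' _; rewrite lee_fin normrM ler_wpM2l//.
  rewrite -lee_fin; apply: le_trans (gram y y'); rewrite /G /Rintegral.
  by case: integral => [r||] //=; rewrite normr0 leey.
have mh1 : measurable_fun [set: Y * Y] (fun z => h z.1 ^+ 2 * k z)%R.
  by apply: measurable_funM => //; apply: measurable_funX; apply: measurableT_comp.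
have mh2 : measurable_fun [set: Y * Y] (fun z => h z.2 ^+ 2 * k z)%R.
  by apply: measurable_funM => //; apply: measurable_funX; apply: measurableT_comp.
have pt y : `|h y * P y|%:E <=
    \int[mY]_y' (h y ^+ 2 * k (y, y'))%:E + \int[mY]_y' (h y' ^+ 2 * k (y, y'))%:E.
  have mkh u : measurable_fun [set: Y] (fun y' => h y ^+ u * k (y, y'))%R.
    exact: measurable_funM.
  have mkh' : measurable_fun [set: Y] (fun y' => h y' ^+ 2 * k (y, y'))%R.
    by apply: measurable_funM => //; exact: measurable_funX.
  rewrite -ge0_integralD//; last 4 first.
  - by move=> y' _; rewrite lee_fin mulr_ge0 ?sqr_ge0.
  - exact/measurable_EFinP.
  - by move=> y' _; rewrite lee_fin mulr_ge0 ?sqr_ge0.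
  - exact/measurable_EFinP.
  rewrite normrM EFinM.
  apply: le_trans (lee_wpmul2l _ (Pk y)) _; first by rewrite lee_fin.
  rewrite -ge0_integralZl_EFin//; last 2 first.
  - by move=> y' _; rewrite lee_fin mulr_ge0.
  - by apply/measurable_EFinP; apply: measurable_funM => //; apply: measurableT_comp.
  apply: ge0_le_integral => //.
  - by move=> y' _; rewrite -EFinM lee_fin !mulr_ge0.
  - by apply: measurable_funeM; apply/measurable_EFinP; apply: measurable_funM => //; apply: measurableT_comp.
  - by apply: emeasurable_funD; apply/measurable_EFinP.
  move=> y' _; rewrite -EFinM -EFinD lee_fin -mulrDl mulrA ler_wpM2r//.
  rewrite -(real_normK (num_real (h y))) -(real_normK (num_real (h y'))).
  have := sqr_ge0 (`|h y| - `|h y'|); have := sqr_ge0 (`|h y| + `|h y'|).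
  by rewrite sqrrB sqrrD; lra.
have mI1 : measurable_fun setT (fun y => \int[mY]_y' (h y ^+ 2 * k (y, y'))%:E).
  by apply: (measurable_fun_integral_snd _
    (f := fun z => (h z.1 ^+ 2 * k z)%:E)); exact/measurable_EFinP.
have mI2 : measurable_fun setT (fun y => \int[mY]_y' (h y' ^+ 2 * k (y, y'))%:E).
  by apply: (measurable_fun_integral_snd _
    (f := fun z => (h z.2 ^+ 2 * k z)%:E)); exact/measurable_EFinP.
have mh2' : measurable_fun setT (fun y => (h y ^+ 2)%:E).
  by apply/measurable_EFinP; exact: measurable_funX.
have h20 x : [set: Y] x -> 0 <= (h x ^+ 2)%:E by rewrite lee_fin sqr_ge0.
have I1 : \int[mY]_y \int[mY]_y' (h y ^+ 2 * k (y, y'))%:E <=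
    A%:E * \int[mY]_y (h y ^+ 2)%:E.
  rewrite -ge0_integralZl//.
  apply: ge0_le_integral => //.
  - by move=> y _; apply: integral_ge0 => y' _; rewrite lee_fin mulr_ge0// sqr_ge0.
  - exact: measurable_funeM.
  move=> y _; under eq_integral do rewrite EFinM.
  have mk1 : measurable_fun setT (fun y' => (k (y, y'))%:E) by exact/measurable_EFinP.
  rewrite ge0_integralZl ?lee_fin ?sqr_ge0//; last by move=> y' _; rewrite lee_fin.
  by rewrite muleC lee_wpmul2r// lee_fin sqr_ge0.
have I2 : \int[mY]_y \int[mY]_y' (h y' ^+ 2 * k (y, y'))%:E <=
    A%:E * \int[mY]_y (h y ^+ 2)%:E.
  have h2k z : 0 <= (h z.2 ^+ 2 * k z)%:E by rewrite lee_fin mulr_ge0// sqr_ge0.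
  have mh2k : measurable_fun setT (fun z => (h z.2 ^+ 2 * k z)%:E).
    exact/measurable_EFinP.
  rewrite (fubini_tonelli (fun z => (h z.2 ^+ 2 * k z)%:E) mh2k h2k)/=.
  rewrite -ge0_integralZl//.
  apply: ge0_le_integral => //.
  - by move=> y _; apply: integral_ge0 => y' _; rewrite lee_fin mulr_ge0// sqr_ge0.
  - exact: (measurable_fun_fubini_tonelli_G (fun z => (h z.2 ^+ 2 * k z)%:E)).
  - exact: measurable_funeM.
  move=> y _; under eq_integral do rewrite EFinM.
  have mk1 : measurable_fun setT (fun y' => (k (y', y))%:E).
    by apply/measurable_EFinP; exact: measurableT_comp.
  rewrite ge0_integralZl ?lee_fin ?sqr_ge0//; last by move=> y' _; rewrite lee_fin.
  by rewrite muleC lee_wpmul2r// lee_fin sqr_ge0.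
apply: (le_trans (lee_abs _)).
apply: (le_trans (le_abse_integral _ _ _)) => //.
  by apply/measurable_EFinP; exact: measurable_funM.
apply: (@le_trans _ _ (\int[mY]_y (\int[mY]_y' (h y ^+ 2 * k (y, y'))%:E +
    \int[mY]_y' (h y' ^+ 2 * k (y, y'))%:E))).
  apply: ge0_le_integral => //.
  - by apply/measurable_EFinP; apply: measurableT_comp => //; exact: measurable_funM.
  - exact: emeasurable_funD.
  - by move=> y _; exact: (pt y).
have J1 y : [set: Y] y -> 0 <= \int[mY]_y' (h y ^+ 2 * k (y, y'))%:E.
  by move=> _; apply: integral_ge0 => y' _; rewrite lee_fin mulr_ge0// sqr_ge0.
have J2 y : [set: Y] y -> 0 <= \int[mY]_y' (h y' ^+ 2 * k (y, y'))%:E.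
  by move=> _; apply: integral_ge0 => y' _; rewrite lee_fin mulr_ge0// sqr_ge0.
rewrite ge0_integralD// mulr2n mulrDl mul1r EFinD ge0_muleDl ?lee_fin//.
exact: leeD.
Qed.

End schur_test.

(** * Lebesgue measure on tuples *)

Section lebesgue_tuple.
Variable R : realType.

Definition cube N (c : R) : set (Rn R N) :=
  [set x | forall i, `[- c, c]%classic (tnth x i)].

Lemma measurable_cube N c : measurable (@cube N c).
Proof. exact: (measurable_box (A := fun=> `[- c, c]%classic)). Qed.

Lemma lebesgue_cube_lty N c : (lebesgue R N (@cube N c) < +oo)%E.
Proof.
rewrite (lebesgue_box (A := fun=> `[- c, c]%classic))//.
rewrite -ge0_fin_numE; last by apply: prode_ge0.
elim/big_ind: _ => // [x y|i _]; first exact: fin_numM.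
by rewrite lebesgue_measure_itv/=; case: ifPn.
Qed.

Lemma sigma_finite_lebesgue N : sigma_finite setT (lebesgue R N).
Proof.
exists (fun k => @cube N k%:R).
  apply/seteqP; split=> // x _; have [k kx] : exists k : nat, forall i, `|tnth x i| <= k%:R.
    exists (\max_(i < N) (Num.truncn `|tnth x i|).+1)%N => i.
    apply: ltW; apply: lt_le_trans (truncnS_gt _) _; rewrite ler_nat.
    exact: (leq_bigmax (F := fun i => (Num.truncn `|tnth x i|).+1)).
  by exists k => //= i; rewrite /= in_itv/= -ler_norml.
by move=> k; split; [exact: measurable_cube|exact: lebesgue_cube_lty].
Qed.

(* [lebesgue R N] is a recursively built measure without a sigma-finite
   structure; this copy carries one, so that Fubini applies. *)
Definition lebesgue_sf N : set (Rn R N) -> \bar R := lebesgue R N.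
Arguments lebesgue_sf : clear implicits.

HB.instance Definition _ N := Measure.on (lebesgue_sf N).
HB.instance Definition _ N :=
  Measure_isSigmaFinite.Build _ _ _ (lebesgue_sf N) (@sigma_finite_lebesgue N).

Local Open Scope ereal_scope.

Lemma integral_lebesgue_sf N (f : Rn R N -> \bar R) :
  \int[lebesgue_sf N]_x f x = \int[lebesgue R N]_x f x.
Proof. exact: eq_measure_integral. Qed.

Lemma integrable_lebesgue_sf N (f : Rn R N -> \bar R) :
  (lebesgue_sf N).-integrable setT f <-> (lebesgue R N).-integrable setT f.
Proof.
by split=> /integrableP[mf fi]; apply/integrableP; split=> //;
  move: fi; rewrite integral_lebesgue_sf.
Qed.

Lemma ge0_integral_lebesgueS N (f : Rn R N.+1 -> \bar R) :
  measurable_fun setT f -> (forall x, 0 <= f x) ->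
  \int[lebesgue R N.+1]_x f x =
  \int[lebesgue R N]_y \int[lebesgue_measure]_a f [tuple of a :: y].
Proof.
move=> mf f0; rewrite /= ge0_integral_pushforward//; last first.
  exact: measurable_tuple_of_pair.
rewrite preimage_setT.
rewrite -(integral_lebesgue_sf (fun y => \int[lebesgue_measure]_a f [tuple of a :: y])).
rewrite -(fubini_tonelli1 (m1 := lebesgue_sf N) (f \o @tuple_of_pair R N))//.
  by apply: measurableT_comp => //; exact: measurable_tuple_of_pair.
by move=> x; exact: f0.
Qed.

Lemma integral_lebesgueS N (f : Rn R N.+1 -> \bar R) :
  (lebesgue R N.+1).-integrable setT f ->
  \int[lebesgue R N.+1]_x f x =
  \int[lebesgue R N]_y \int[lebesgue_measure]_a f [tuple of a :: y].
Proof.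
move=> fi; have mf := measurable_int _ fi.
have mt := @measurable_tuple_of_pair R N.
have ft : (lebesgue_sf N \x (@lebesgue_measure R)).-integrable setT (f \o @tuple_of_pair R N).
  apply/integrableP; split; first exact: measurableT_comp.
  have /integrableP[_] := fi.
  by rewrite /= ge0_integral_pushforward//; exact: measurableT_comp.
rewrite /= integral_pushforward//.
rewrite preimage_setT.
rewrite -(integral_lebesgue_sf (fun y => \int[lebesgue_measure]_a f [tuple of a :: y])).
by rewrite -(integral12_prod_meas1 ft).
Qed.

End lebesgue_tuple.

(** * A weight with integrable Fourier transform *)

Section parabola.
Variable R : realType.
Implicit Types (x z p : R).

(* Any compactly supported even weight, positive on [[-1, 1]], whose Fourier
   transform is integrable would do. *)
Definition parabola x : R := Num.max 0 (4 - x ^+ 2).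

Lemma parabola_ge0 x : 0 <= parabola x.
Proof. by rewrite /parabola le_max lexx. Qed.

Lemma measurable_parabola : measurable_fun setT parabola.
Proof.
by apply: measurable_maxr => //; apply: measurable_funB => //; exact: measurable_funX.
Qed.

Lemma integral_parabolaM (f : R -> R) :
  (\int[lebesgue_measure]_x (parabola x * f x)%:E =
   \int[lebesgue_measure]_(x in `[(- 2)%R, 2%R]) ((4 - x ^+ 2) * f x)%:E)%E.
Proof.
rewrite [RHS]integral_mkcond; apply: eq_integral => x _.
rewrite patchE; case: ifPn => [|/negP xI].
  rewrite inE/= in_itv/= /parabola => /andP[x1 x2].
  by rewrite max_r//; nra.
rewrite /parabola max_l ?mul0r// leNgt; apply/negP => h; apply: xI.
by rewrite inE/= in_itv/=; apply/andP; split; rewrite leNgt; apply/negP => ?; nra.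
Qed.

Lemma integrable_parabola :
  lebesgue_measure.-integrable setT (EFin \o parabola).
Proof.
apply/integrableP; split.
  by apply/measurable_EFinP; exact: measurable_parabola.
have -> : (\int[lebesgue_measure]_x `|(EFin \o parabola) x| =
    \int[lebesgue_measure]_x (parabola x * 1)%:E)%E.
  by apply: eq_integral => x _; rewrite /= mulr1 ger0_norm ?parabola_ge0.
rewrite (integral_parabolaM (fun=> 1)).
apply: integrable_lty => //.
apply: continuous_compact_integrable; first exact: segment_compact.
apply: continuous_subspaceT => x.
by apply: cvgM; [apply: cvgB; [exact: cvg_cst|exact: exprn_continuous]|exact: cvg_cst].
Qed.

Let cosM z p x : R := (4 - x ^+ 2) * cos (x * z + p).

(** Found by integrating by parts twice. Its only term of order [1/z] carries the factor [4 - x^2],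
    which vanishes at both endpoints; this is why the transform decays like [z^-2]. *)
Let primitive z p x : R := (4 - x ^+ 2) * sin (x * z + p) / z
  - 2 * x * cos (x * z + p) / z ^+ 2 + 2 * sin (x * z + p) / z ^+ 3.

Let is_derive_primitive z p x : z != 0 -> is_derive x 1 (primitive z p) (cosM z p x).
Proof.
move=> z0; have dl : is_derive x 1 (fun x => x * z + p) z.
  by apply: is_derive_eq; rewrite /GRing.scale/= !(mulr1,mul1r,mulr0,addr0,add0r).
have ds : is_derive x 1 (fun x => sin (x * z + p)) (cos (x * z + p) * z).
  exact: (is_derive1_comp (f := @sin R)).
have dc : is_derive x 1 (fun x => cos (x * z + p)) (- sin (x * z + p) * z).
  exact: (is_derive1_comp (f := @cos R)).
apply: is_derive_eq; rewrite /GRing.scale/= /cosM.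
by field.
Qed.

Let continuous_cosM z p : continuous (cosM z p).
Proof.
move=> x; apply: cvgM.
  by apply: cvgB; [exact: cvg_cst|exact: exprn_continuous].
apply: (@continuous_comp _ _ _ (fun x => x * z + p) (@cos R)); last exact: continuous_cos.
by apply: cvgD; [apply: cvgM; [exact: cvg_id|exact: cvg_cst]|exact: cvg_cst].
Qed.

(** For [|z| <= 1] the trivial bound is 4 times the length 4, and [1 + z^2 <= 2] gives 32. For
    [|z| > 1] the endpoint values of [primitive], multiplied by [1 + z^2], give at most [2 * 12]. *)
Lemma parabola_fourier z p :
  (`| \int[lebesgue_measure]_x (parabola x * cos (x * z + p))%:E |
   <= (32 * (oneDsqr z)^-1)%:E)%E.
Proof.
have o0 : 0 < oneDsqr z by rewrite (lt_le_trans _ (oneDsqr_ge1 z)).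
rewrite integral_parabolaM.
have [z1|z1] := leP `|z| 1.
  have mcM : measurable_fun (`[(-2)%R, 2%R]%classic : set (measurableTypeR R)) (EFin \o cosM z p).
    apply/measurable_EFinP/measurable_funTS.
    exact: continuous_measurable_fun (@continuous_cosM z p).
  apply: (le_trans (le_abse_integral _ _ _)) => //.
  apply: (@le_trans _ _ (\int[lebesgue_measure]_(x in `[(-2)%R, 2%R]) (cst 4%:E) x)%E).
    apply: ge0_le_integral => //.
    - exact: measurableT_comp.
    - move=> x /=; rewrite in_itv/= => /andP[x1 x2].
      rewrite lee_fin normrM -[leRHS]mulr1 ler_pM// ?cos_max//.
      by rewrite ler_norml; nra.
  rewrite integral_cst//= lebesgue_measure_itv/= lte_fin ifT; last by lra.
  rewrite -EFinD -EFinM lee_fin ler_pdivlMr// /oneDsqr.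
  have : z ^+ 2 <= 1 by rewrite -real_normK ?num_real// expr_le1.
  by nra.
have z0 : z != 0 by rewrite -normr_gt0 (lt_trans _ z1).
rewrite (@continuous_FTC2 _ _ (primitive z p)).
- rewrite /primitive -EFinD /= lee_fin.
  rewrite ler_pdivlMr// -[oneDsqr z]ger0_norm ?(ltW o0)// -normrM.
  set c1 := cos (2 * z + p); set s1 := sin (2 * z + p).
  set c2 := cos (-2 * z + p); set s2 := sin (-2 * z + p).
  rewrite (_ : _ * oneDsqr z =
      (z ^- 2 + 1) * (- 4 * c1 - 4 * c2 + 2 * z^-1 * (s1 - s2))); last first.
    by rewrite /oneDsqr; field.
  have u1 : `|z^-1| <= 1 by rewrite normfV invf_le1 ?normr_gt0 ?(ltW z1).
  have u2 : z ^- 2 <= 1.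
    by rewrite -exprVn -(real_normK (num_real z^-1)) expr_le1.
  have : `|c1| <= 1 by exact: cos_max.
  have : `|c2| <= 1 by exact: cos_max.
  have : `|s1| <= 1 by exact: sin_max.
  have : `|s2| <= 1 by exact: sin_max.
  move=> hs2 hs1 hc2 hc1.
  have u20 : 0 <= z ^- 2 by rewrite invr_ge0 sqr_ge0.
  rewrite normrM; apply: (@le_trans _ _ (2 * 12)); last by lra.
  rewrite ler_pM//; first by rewrite ger0_norm; lra.
  have hs : `|z^-1 * (s1 - s2)| <= 2.
    rewrite normrM -[leRHS]mul1r ler_pM// (le_trans (ler_normB _ _))//; lra.
  move: hs hc1 hc2; rewrite -mulrA !ler_norml; lra.
- lra.
- exact/continuous_subspaceT/continuous_cosM.
- have cp x : primitive z p @ x --> primitive z p x.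
    apply: differentiable_continuous; apply/derivable1_diffP.
    by have [] := is_derive_primitive p x z0.
  split.
  + by move=> x _; have [] := is_derive_primitive p x z0.
  + exact/cvg_at_right_filter/cp.
  + exact/cvg_at_left_filter/cp.
- move=> x _; rewrite derive1E; by have [_ ->] := is_derive_primitive p x z0.
Qed.

End parabola.

(** * Cauchy kernels and integrals of tensor products *)

Section cauchy_kernel.
Variable R : realType.

Definition cauchy_kernel (z : R) : R := 32 * (oneDsqr z)^-1.

Lemma cauchy_kernel_ge0 z : 0 <= cauchy_kernel z.
Proof. by rewrite mulr_ge0// invr_ge0 (le_trans ler01)// oneDsqr_ge1. Qed.

Lemma continuous_cauchy_kernel : continuous cauchy_kernel.
Proof. by move=> x; apply: cvgM; [exact: cvg_cst|exact: continuous_oneDsqrV]. Qed.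

Lemma measurable_cauchy_kernel : measurable_fun setT cauchy_kernel.
Proof. exact: continuous_measurable_fun continuous_cauchy_kernel. Qed.

Lemma cauchy_kernelN z : cauchy_kernel (- z) = cauchy_kernel z.
Proof. by rewrite /cauchy_kernel /oneDsqr sqrrN. Qed.

Let integral_cauchy_kernel0 :
  (\int[lebesgue_measure]_x (cauchy_kernel x)%:E = (32 * pi)%:E)%E.
Proof.
rewrite ge0_symfun_integralT; last 3 first.
- exact: cauchy_kernel_ge0.
- exact: continuous_cauchy_kernel.
- by move=> x /=; rewrite cauchy_kernelN.
rewrite -set_itvcy.
under eq_integral do rewrite EFinM.
rewrite ge0_integralZl_EFin//.
- by rewrite integral0y_oneDsqr -!EFinM; congr EFin; field.
- apply/measurable_EFinP/measurable_funTS.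
  exact: continuous_measurable_fun (@continuous_oneDsqrV R).
Qed.

Lemma integral_cauchy_kernel a :
  (\int[lebesgue_measure]_x (cauchy_kernel (x + a))%:E = (32 * pi)%:E)%E.
Proof.
have dF (x : R) : is_derive x 1 (fun x : R => x + a) 1.
  by apply: is_derive_eq; rewrite addr0.
have dE : (fun x : R => x + a)^`()%classic = cst 1.
  by apply/funext => x; rewrite derive1E; have [_ ->] := dF x.
rewrite -integral_cauchy_kernel0.
rewrite [RHS](increasing_ge0_integration_by_substitutionT (F := fun x => x + a)).
- by apply: eq_integral => x _; rewrite dE /= mulr1.
- by move=> x y xy; rewrite ltrD2r.
- by rewrite dE; exact: cst_continuous.
- by rewrite dE; exact: is_cvg_cst.
- by rewrite dE; exact: is_cvg_cst.
- by move=> x; have [] := dF x.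
- apply/cvgrNyPle => A; near=> x; rewrite -lerBrDr; near: x.
  exact: nbhs_ninfty_le (num_real _).
- apply/cvgryPge => A; near=> x; rewrite -lerBlDr; near: x.
  exact: nbhs_pinfty_ge (num_real _).
- exact: continuous_cauchy_kernel.
- exact: cauchy_kernel_ge0.
Unshelve. all: by end_near. Qed.

Local Open Scope ereal_scope.

Lemma measurable_prod_tnth N (g : 'I_N -> R -> R) :
  (forall i, measurable_fun setT (g i)) ->
  measurable_fun setT (fun x : Rn R N => (\prod_(i < N) g i (tnth x i))%R).
Proof.
move=> mg; apply: measurable_prod => i _.
exact: (measurableT_comp (mg i) (@measurable_tnth _ _ N i)).
Qed.

Lemma integral_lebesgue_prod N (g : 'I_N -> R -> R) :
  (forall i, measurable_fun setT (g i)) -> (forall i x, 0 <= g i x)%R ->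
  \int[lebesgue R N]_x (\prod_(i < N) g i (tnth x i))%:E =
  \prod_(i < N) \int[lebesgue_measure]_a (g i a)%:E.
Proof.
elim: N g => [|N IH] g mg g0.
  rewrite big_ord0 /=.
  rewrite integral_dirac//.
    by rewrite diracT mul1e big_ord0.
  under eq_fun do rewrite big_ord0.
  exact: measurable_cst.
have mG n (f : 'I_n -> R -> R) : (forall i, measurable_fun setT (f i)) ->
    measurable_fun setT (fun x : Rn R n => (\prod_(i < n) f i (tnth x i))%:E).
  by move=> mf; apply/measurable_EFinP; exact: measurable_prod_tnth.
rewrite (ge0_integral_lebesgueS (mG _ _ mg)); last first.
  by move=> x; rewrite lee_fin; apply: prodr_ge0.
rewrite big_ord_recl.
rewrite (eq_integral (fun y : Rn R N =>
    (\prod_(i < N) g (lift ord0 i) (tnth y i))%:E *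
    \int[lebesgue_measure]_a (g ord0 a)%:E)); last first.
  move=> y _; rewrite -ge0_integralZl_EFin//.
  - apply: eq_integral => a _.
    rewrite big_ord_recl tnth0 -EFinM mulrC; congr (_ * _)%:E.
    by apply: eq_bigr => i _; rewrite tnthS.
  - by move=> a _; rewrite lee_fin.
  - by apply/measurable_EFinP; exact: mg.
  - by apply: prodr_ge0.
rewrite ge0_integralZr//; last 3 first.
- exact: (mG _ (fun i => g (lift ord0 i))).
- by move=> x _; rewrite lee_fin; apply: prodr_ge0.
- by apply: integral_ge0 => x _; rewrite lee_fin.
by rewrite (IH (fun i => g (lift ord0 i)))// muleC.
Qed.

End cauchy_kernel.

(** * The product weight and its cosine transform *)

Section weight.
Variable R : realType.
Local Open Scope ereal_scope.

Lemma integrable_parabolaM (f : measurableTypeR R -> R) : measurable_fun setT f ->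
  (forall x, `|f x| <= 1)%R ->
  lebesgue_measure.-integrable setT (fun x => (parabola x * f x)%:E).
Proof.
move=> mf f1; under eq_fun do rewrite mulrC.
exact: (integrable_boundedM mf f1 (@integrable_parabola R)).
Qed.

Definition parabola_hat (z : R) : R :=
  (\int[lebesgue_measure]_x (parabola x * cos (x * z)))%R.

Let continuous_affine (z p : R) : continuous (fun x : R => x * z + p)%R.
Proof. by move=> x; apply: cvgD; [apply: cvgM; [exact: cvg_id|exact: cvg_cst]|exact: cvg_cst]. Qed.

Let continuous_cos_affine (z p : R) : continuous (fun x : R => cos (x * z + p)).
Proof.
move=> x; apply: (@continuous_comp R R R (fun x => x * z + p)%R (@cos R)).
  exact: continuous_affine.
exact: continuous_cos.
Qed.

Let continuous_sin_affine (z p : R) : continuous (fun x : R => sin (x * z + p)).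
Proof.
move=> x; apply: (@continuous_comp R R R (fun x => x * z + p)%R (@sin R)).
  exact: continuous_affine.
exact: continuous_sin.
Qed.

Let measurable_cos_affine (z p : R) :
  measurable_fun setT (fun x : R => cos (x * z + p)).
Proof. exact: continuous_measurable_fun (@continuous_cos_affine z p). Qed.

Let measurable_sin_affine (z p : R) :
  measurable_fun setT (fun x : R => sin (x * z + p)).
Proof. exact: continuous_measurable_fun (@continuous_sin_affine z p). Qed.

(** The integrand is odd, so reflection gives [S = - S]; finiteness of [S] excludes the infinite
    solutions of this equation. *)
Lemma integral_parabola_sin (z : R) :
  \int[lebesgue_measure]_x (parabola x * sin (x * z))%:E = 0.
Proof.
have cS : continuous (fun x : R => (4 - x ^+ 2) * sin (x * z))%R.
  move=> x; apply: cvgM.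
    by apply: cvgB; [exact: cvg_cst|exact: exprn_continuous].
  by under eq_fun do rewrite -[(_ * z)%R]addr0; rewrite -[(x * z)%R]addr0;
    exact: continuous_sin_affine.
have iS : lebesgue_measure.-integrable `[(-2)%R, 2%R]%classic
    (fun x => ((4 - x ^+ 2) * sin (x * z))%:E).
  apply: continuous_compact_integrable; first exact: segment_compact.
  exact: continuous_subspaceT.
rewrite integral_parabolaM.
set S := integral _ _ _; have SN : S = - S.
  rewrite {1}/S -[X in `[_, X]]opprK integration_by_substitution_oppr; last 2 first.
  - lra.
  - exact: continuous_subspaceT.
  rewrite /S -integralN; last exact: integrable_add_def.
  by apply: eq_integral => x _; rewrite /= sqrrN mulNr sinN mulrN EFinN.
have : S \is a fin_num by apply: integrable_fin_num.
by case: S SN => [r||]// [SN] _; congr EFin; lra.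
Qed.

Lemma integral_parabola_cos (z p : R) :
  \int[lebesgue_measure]_x (parabola x * cos (x * z + p))%:E =
  (parabola_hat z * cos p)%:E.
Proof.
have mc : measurable_fun setT (fun x : R => cos (x * z)).
  by under eq_fun do rewrite -[(_ * z)%R]addr0; exact: measurable_cos_affine.
have ms : measurable_fun setT (fun x : R => sin (x * z)).
  by under eq_fun do rewrite -[(_ * z)%R]addr0; exact: measurable_sin_affine.
have ic := integrable_parabolaM mc (fun x => cos_max _).
have is' := integrable_parabolaM ms (fun x => sin_max _).
transitivity (\int[lebesgue_measure]_x ((cos p)%:E * (parabola x * cos (x * z))%:E -
   (sin p)%:E * (parabola x * sin (x * z))%:E)).
  apply: eq_integral => x _; rewrite -!EFinM -EFinB cosD; congr EFin; ring.
rewrite integralB//; last 2 first.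
- exact: integrableZl.
- exact: integrableZl.
rewrite !integralZl// integral_parabola_sin mule0 sube0.
rewrite /parabola_hat /Rintegral EFinM fineK 1?muleC//.
exact: integrable_fin_num.
Qed.

Lemma parabola_hat_le (z : R) : (`|parabola_hat z| <= cauchy_kernel z)%R.
Proof.
rewrite -lee_fin -[parabola_hat z]mulr1 -cos0.
have := parabola_fourier z 0.
by rewrite integral_parabola_cos.
Qed.

Definition weight N (x : Rn R N) : R := (\prod_(i < N) parabola (tnth x i))%R.

Lemma weight_ge0 N (x : Rn R N) : (0 <= weight x)%R.
Proof. by apply: prodr_ge0 => i _; exact: parabola_ge0. Qed.

Lemma measurable_weight N : measurable_fun setT (@weight N).
Proof.
by apply: (measurable_prod_tnth (g := fun=> @parabola R)) => _; exact: measurable_parabola.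
Qed.

Lemma integrable_weight N : (lebesgue R N).-integrable setT (EFin \o @weight N).
Proof.
apply/integrableP; split; first by apply/measurable_EFinP; exact: measurable_weight.
under eq_integral do rewrite /= ger0_norm ?weight_ge0//.
rewrite (integral_lebesgue_prod (g := fun=> @parabola R))//; last 2 first.
- by move=> _; exact: measurable_parabola.
- by move=> _; exact: parabola_ge0.
rewrite -ge0_fin_numE; last first.
  by apply: prode_ge0 => i _; apply: integral_ge0 => x _; rewrite lee_fin parabola_ge0.
elim/big_ind: _ => // [x y|i _]; first exact: fin_numM.
by apply: integrable_fin_num => //; exact: integrable_parabola.
Qed.

Let lin N (z : 'I_N -> R) (x : Rn R N) : R := (\sum_(i < N) tnth x i * z i)%R.

Lemma measurable_lin N (z : 'I_N -> R) : measurable_fun setT (lin z).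
Proof.
apply: measurable_sum => i; apply: measurable_funM => //.
exact: measurable_tnth.
Qed.

(** The free phase [p] makes the induction close: while the first coordinate is integrated, the
    others are part of its phase. No sine terms appear because each factor of the weight is even. *)
Lemma integral_weight_cos N (z : 'I_N -> R) (p : R) :
  \int[lebesgue R N]_x (weight x * cos (\sum_(i < N) tnth x i * z i + p))%:E =
  ((\prod_(i < N) parabola_hat (z i)) * cos p)%:E.
Proof.
have mcl n u : measurable_fun setT (fun x => cos (@lin n u x + p)).
  apply: (measurableT_comp (f := @cos R)).
    exact: continuous_measurable_fun (@continuous_cos R).
  by apply: measurable_funD => //; exact: measurable_lin.
have iw n (u : 'I_n -> R) : (lebesgue R n).-integrable setT
    (fun x => (weight x * cos (lin u x + p))%:E).
  under eq_fun do rewrite mulrC.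
  apply: (integrable_boundedM (M := 1)) => //.
  - exact: mcl.
  - by move=> x; exact: cos_max.
  - exact: integrable_weight.
elim: N z => [|N IH] z.
  rewrite big_ord0 /= integral_dirac//.
  - by rewrite diracT mul1e /weight !big_ord0 add0r.
  - by have /integrableP[] := iw _ z.
rewrite integral_lebesgueS//; last exact: iw.
transitivity (\int[lebesgue R N]_y ((parabola_hat (z ord0))%:E *
  (weight y * cos (lin (z \o lift ord0) y + p))%:E)).
  apply: eq_integral => y _.
  transitivity (\int[lebesgue_measure]_a ((weight y)%:E *
     (parabola a * cos (a * z ord0 + (lin (z \o lift ord0) y + p)))%:E)).
    apply: eq_integral => a _; rewrite -EFinM /weight !big_ord_recl !tnth0.
    rewrite mulrA [(_ * parabola a)%R]mulrC addrA; congr (_ * _ * cos (_ + _ + _))%:E.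
      by apply: eq_bigr => i _; rewrite tnthS.
    by apply: eq_bigr => i _; rewrite tnthS.
  rewrite integralZl//; last first.
    by apply: integrable_parabolaM => [|x]; [exact: measurable_cos_affine|exact: cos_max].
  by rewrite integral_parabola_cos -!EFinM; congr EFin; ring.
rewrite integralZl//.
by rewrite IH -EFinM big_ord_recl mulrA.
Qed.

End weight.

(** * The local [L^2] bound *)

Section adjoint_fourier_bound.
Variables (R : realType) (N : nat).
Local Notation Rn := (Rn R N).
Local Open Scope ereal_scope.

Lemma measurable_dotp : measurable_fun setT (fun z : Rn * Rn => dotp z.1 z.2).
Proof.
apply: measurable_sum => i; apply: measurable_funM.
  exact: (measurableT_comp (@measurable_tnth _ _ N i)).
exact: (measurableT_comp (@measurable_tnth _ _ N i)).
Qed.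

Lemma measurable_cos_comp d (T : measurableType d) (f : T -> R) :
  measurable_fun setT f -> measurable_fun setT (fun x => cos (f x)).
Proof.
by move=> mf; apply: (measurableT_comp (f := @cos R)) => //;
  exact: continuous_measurable_fun (@continuous_cos R).
Qed.

(** A product of two cosines is half the sum of the cosines of the difference and of the sum of the
    phases. Hence one product of Cauchy kernels for [y' - y] and one for [y' + y]; each integrates
    to [(32 pi)^N]. *)
Let ker (z : Rn * Rn) : R :=
  (\prod_(i < N) cauchy_kernel (tnth z.2 i - tnth z.1 i) +
   \prod_(i < N) cauchy_kernel (tnth z.2 i + tnth z.1 i))%R.

Let kersym x y : ker (x, y) = ker (y, x).
Proof.
rewrite /ker /=; congr (_ + _)%R; apply: eq_bigr => i _.
  by rewrite -cauchy_kernelN opprB.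
by rewrite addrC.
Qed.

Let mkerp (z : Rn) e : measurable_fun setT (fun x : Rn =>
  (\prod_(i < N) cauchy_kernel (tnth x i + e i))%R).
Proof.
apply: (measurable_prod_tnth (g := fun i a => cauchy_kernel (a + e i))) => i.
apply: measurableT_comp; first exact: measurable_cauchy_kernel.
exact: measurable_funD.
Qed.

Let int_kerp (e : 'I_N -> R) :
  \int[lebesgue R N]_x (\prod_(i < N) cauchy_kernel (tnth x i + e i))%:E =
  ((32 * pi) ^+ N)%:E.
Proof.
rewrite (integral_lebesgue_prod (g := fun i a => cauchy_kernel (a + e i))).
- under eq_bigr do rewrite integral_cauchy_kernel.
  rewrite big_const card_ord; elim: N => //= n ->.
  by rewrite -EFinM exprS.
- move=> i; apply: measurableT_comp; first exact: measurable_cauchy_kernel.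
  exact: measurable_funD.
- by move=> i x; exact: cauchy_kernel_ge0.
Qed.

Let A : R := (2 * (32 * pi) ^+ N)%R.

Let int_ker x : \int[lebesgue R N]_y (ker (x, y))%:E = A%:E.
Proof.
rewrite /ker /=; under eq_integral do rewrite EFinD.
rewrite ge0_integralD//; last 4 first.
- by move=> y _; rewrite lee_fin; apply: prodr_ge0 => i _; exact: cauchy_kernel_ge0.
- by apply/measurable_EFinP; exact: (mkerp x (fun i => - tnth x i)%R).
- by move=> y _; rewrite lee_fin; apply: prodr_ge0 => i _; exact: cauchy_kernel_ge0.
- by apply/measurable_EFinP; exact: (mkerp x (fun i => tnth x i)%R).
by rewrite !int_kerp -EFinD /A; congr EFin; ring.
Qed.

Let mker : measurable_fun setT ker.
Proof.
have mt (f : Rn * Rn -> Rn) i : measurable_fun setT f ->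
    measurable_fun setT (fun z => tnth (f z) i).
  exact: (measurableT_comp (@measurable_tnth _ _ N i)).
apply: measurable_funD; apply: measurable_prod => i _;
  (apply: measurableT_comp; first exact: measurable_cauchy_kernel).
  by apply: measurable_funB; exact: mt.
by apply: measurable_funD; exact: mt.
Qed.

Let gram (p : R) (y y' : Rn) :
  `| \int[lebesgue R N]_x
       (weight x * (cos (dotp x y + p) * cos (dotp x y' + p)))%:E |
  <= (ker (y, y'))%:E.
Proof.
pose zm i := (tnth y' i - tnth y i)%R; pose zp i := (tnth y' i + tnth y i)%R.
have iw (z : 'I_N -> R) q : (lebesgue R N).-integrable setT
    (fun x => (weight x * cos (\sum_(i < N) tnth x i * z i + q))%:E).
  under eq_fun do rewrite mulrC.
  apply: (integrable_boundedM (M := 1)) => //.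
  - apply: measurable_cos_comp; apply: measurable_funD => //; exact: measurable_lin.
  - by move=> x; exact: cos_max.
  - exact: integrable_weight.
rewrite (eq_integral (fun x : Rn =>
   2^-1%:E * (weight x * cos (\sum_(i < N) tnth x i * zm i + 0))%:E +
   2^-1%:E * (weight x * cos (\sum_(i < N) tnth x i * zp i + 2 * p))%:E)); last first.
  move=> x _; rewrite -!EFinM -EFinD -!mulrDr; congr EFin.
  have -> : (\sum_(i < N) tnth x i * zm i + 0 = (dotp x y' + p) - (dotp x y + p))%R.
    rewrite addr0 /zm /dotp; under eq_bigr do rewrite mulrBr.
    by rewrite sumrB; ring.
  have -> : (\sum_(i < N) tnth x i * zp i + 2 * p = (dotp x y' + p) + (dotp x y + p))%R.
    rewrite /zp /dotp; under eq_bigr do rewrite mulrDr.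
    by rewrite big_split /=; ring.
  move: (dotp x y + p)%R (dotp x y' + p)%R => a b.
  by rewrite cosB cosD; field.
rewrite integralD//; last 2 first.
- exact/integrableZl/iw.
- exact/integrableZl/iw.
rewrite !integralZl//.
rewrite !integral_weight_cos -!EFinM -EFinD lee_fin.
apply: le_trans (ler_normD _ _) _.
have b (z : 'I_N -> R) q : (`|2^-1 * (\prod_(i < N) parabola_hat (z i) * cos q)| <=
    \prod_(i < N) cauchy_kernel (z i))%R.
  rewrite !normrM normr_prod -[leRHS]mul1r ler_pM//.
  - by rewrite mulr_ge0// prodr_ge0.
  - by rewrite ger0_norm; lra.
  rewrite -[leRHS]mulr1 ler_pM// ?cos_max//; first by rewrite prodr_ge0.
  by apply: ler_prod => i _; rewrite normr_ge0 parabola_hat_le.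
by apply: lerD; apply: b.
Qed.

Lemma fourier_cos_bound (h : Rn -> R) (p : R) :
  (lebesgue R N).-integrable setT (EFin \o h) ->
  \int[lebesgue R N]_x (weight x *
     (\int[lebesgue R N]_y (cos (dotp x y + p) * h y))%R ^+ 2)%:E <=
  (2 * A)%:E * \int[lebesgue R N]_y (h y ^+ 2)%:E.
Proof.
move=> ih.
pose L := @lebesgue_sf R N : {sigma_finite_measure set Rn -> \bar R}.
have := @schur_test _ _ Rn Rn R L L (@weight R N)
  (fun z => cos (dotp z.1 z.2 + p)) ker A.
rewrite /L /Rintegral !integral_lebesgue_sf.
under eq_integral do rewrite !integral_lebesgue_sf.
apply.
- exact: weight_ge0.
- by apply/integrable_lebesgue_sf; exact: integrable_weight.
- by apply: measurable_cos_comp; apply: measurable_funD => //; exact: measurable_dotp.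
- by move=> z; exact: cos_max.
- exact: mker.
- by move=> z; apply: addr_ge0; apply: prodr_ge0 => i _; exact: cauchy_kernel_ge0.
- by move=> y y'; rewrite integral_lebesgue_sf; exact: gram.
- by move=> y; rewrite integral_lebesgue_sf int_ker.
- move=> y; rewrite integral_lebesgue_sf.
  by under eq_integral do rewrite kersym; rewrite int_ker.
- by apply/integrable_lebesgue_sf.
Qed.

End adjoint_fourier_bound.

(** * The local bound for complex-valued data *)

Section complex_adjoint.
Variables (R : realType) (N : nat).
Local Notation Rn := (Rn R N).
Local Notation mu := (lebesgue R N).
Local Open Scope complex_scope.

(** The squared modulus, kept polynomial in the components so that [ring] and [lra] apply; square
    roots return only with the norms. *)
Definition sqn (z : R[i]) : R := complex.Re z ^+ 2 + complex.Im z ^+ 2.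

Lemma sqn_ge0 z : 0 <= sqn z.
Proof. by rewrite addr_ge0// sqr_ge0. Qed.

Lemma normc_sqn z : Normc.normc z = Num.sqrt (sqn z).
Proof. by case: z. Qed.

Lemma sqnM z w : sqn (z * w) = sqn z * sqn w.
Proof. by case: z w => [a b] [c d]; rewrite /sqn /=; ring. Qed.

Lemma sqn_cis a : sqn (cis a) = 1.
Proof. by rewrite /sqn/= cos2Dsin2. Qed.

Lemma sqn0 : sqn 0 = 0.
Proof. by rewrite /sqn/= expr0n/= addr0. Qed.

(* The factor 4/3 is iterated over the scales; it has to be less than
   [2^(1-s)], for all [s < 1/2]. *)
Lemma sqn_addw z w : sqn (z + w) <= 4 * sqn z + 4 / 3 * sqn w.
Proof.
case: z w => [a b] [c d]; rewrite /sqn /=.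
have := sqr_ge0 (3 * a - c); have := sqr_ge0 (3 * b - d); lra.
Qed.

Lemma sqn_add z w : sqn (z + w) <= 2 * sqn z + 2 * sqn w.
Proof.
case: z w => [a b] [c d]; rewrite /sqn /=.
have := sqr_ge0 (a - c); have := sqr_ge0 (b - d); lra.
Qed.

Lemma sqnN z : sqn (- z) = sqn z.
Proof. by case: z => [a b]; rewrite /sqn /= !sqrrN. Qed.

Lemma ReD (z w : R[i]) : complex.Re (z + w) = complex.Re z + complex.Re w.
Proof. by case: z w => [a b] [c d]. Qed.
Lemma ImD (z w : R[i]) : complex.Im (z + w) = complex.Im z + complex.Im w.
Proof. by case: z w => [a b] [c d]. Qed.
Lemma ReM (z w : R[i]) : complex.Re (z * w) =
  complex.Re z * complex.Re w - complex.Im z * complex.Im w.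
Proof. by case: z w => [a b] [c d]. Qed.
Lemma ImM (z w : R[i]) : complex.Im (z * w) =
  complex.Re z * complex.Im w + complex.Im z * complex.Re w.
Proof. by case: z w => [a b] [c d] /=. Qed.

Definition cintegrable (g : Rn -> R[i]) :=
  mu.-integrable setT (fun x => (complex.Re (g x))%:E) /\
  mu.-integrable setT (fun x => (complex.Im (g x))%:E).

Lemma cintegrable_measurable g : cintegrable g -> cmeasurable g.
Proof.
by move=> [/measurable_int/measurable_EFinP ? /measurable_int/measurable_EFinP ?].
Qed.

Lemma cmeasurableM g1 g2 : cmeasurable g1 -> cmeasurable g2 ->
  cmeasurable (fun x : Rn => g1 x * g2 x).
Proof.
move=> [r1 i1] [r2 i2]; split.
  under eq_fun do rewrite ReM.
  by apply: measurable_funB; exact: measurable_funM.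
under eq_fun do rewrite ImM.
by apply: measurable_funD; exact: measurable_funM.
Qed.

Lemma cmeasurableD g1 g2 : cmeasurable g1 -> cmeasurable g2 ->
  cmeasurable (fun x : Rn => g1 x + g2 x).
Proof.
move=> [r1 i1] [r2 i2]; split.
  by under eq_fun do rewrite ReD; exact: measurable_funD.
by under eq_fun do rewrite ImD; exact: measurable_funD.
Qed.

Lemma cmeasurable_cis (f : Rn -> R) : measurable_fun setT f ->
  cmeasurable (fun x => cis (f x)).
Proof.
move=> mf; split; first exact: measurable_cos_comp.
by apply: (measurableT_comp (f := @sin R)) => //;
  exact: continuous_measurable_fun (@continuous_sin R).
Qed.

Lemma measurable_sqn g : cmeasurable g -> measurable_fun setT (fun x : Rn => sqn (g x)).
Proof. by move=> [r i]; apply: measurable_funD; exact: measurable_funX. Qed.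

Lemma cintegrableM m g : cmeasurable m -> (exists M, forall x, sqn (m x) <= M) ->
  cintegrable g -> cintegrable (fun x => m x * g x).
Proof.
move=> [rm im] [M mM] [rg ig].
have Mr x : `|complex.Re (m x)| <= Num.sqrt M.
  rewrite -sqrtr_sqr ler_wsqrtr// (le_trans _ (mM x))//.
  by rewrite /sqn lerDl sqr_ge0.
have Mi x : `|complex.Im (m x)| <= Num.sqrt M.
  rewrite -sqrtr_sqr ler_wsqrtr// (le_trans _ (mM x))//.
  by rewrite /sqn lerDr sqr_ge0.
split.
  under eq_fun do rewrite ReM EFinB.
  by apply: integrableB => //; [exact: (integrable_boundedM rm Mr)|exact: (integrable_boundedM im Mi)].
under eq_fun do rewrite ImM EFinD.
by apply: integrableD => //; [exact: (integrable_boundedM rm Mr)|exact: (integrable_boundedM im Mi)].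
Qed.

Definition adjoint_fourier (g : Rn -> R[i]) (x : Rn) : R[i] :=
  cintegral (fun xi => cis (dotp x xi) * g xi).

Let measurable_dotpr x : measurable_fun setT (fun y : Rn => dotp x y).
Proof.
by apply: measurable_sum => i; apply: measurable_funM => //; exact: measurable_tnth.
Qed.

Lemma cintegrable_cisM (f : Rn -> R) g : measurable_fun setT f -> cintegrable g ->
  cintegrable (fun x => cis (f x) * g x).
Proof.
move=> mf; apply: cintegrableM; first exact: cmeasurable_cis.
by exists 1 => x; rewrite sqn_cis.
Qed.

Lemma cintegralD g1 g2 : cintegrable g1 -> cintegrable g2 ->
  cintegral (fun x => g1 x + g2 x) = cintegral g1 + cintegral g2.
Proof.
move=> [r1 i1] [r2 i2]; rewrite /cintegral.
rewrite -[RHS]/((_ + _) +i* (_ + _)).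
under eq_Rintegral do rewrite ReD.
rewrite RintegralD//; congr (_ +i* _).
under eq_Rintegral do rewrite ImD.
by rewrite RintegralD.
Qed.

Lemma adjoint_fourierD g1 g2 x : cintegrable g1 -> cintegrable g2 ->
  adjoint_fourier (fun xi => g1 xi + g2 xi) x = adjoint_fourier g1 x + adjoint_fourier g2 x.
Proof.
move=> i1 i2; rewrite /adjoint_fourier -cintegralD.
- by congr cintegral; apply/funext => y; rewrite mulrDr.
- by apply: cintegrable_cisM.
- by apply: cintegrable_cisM.
Qed.

Lemma cintegrableN g : cintegrable g -> cintegrable (fun x => - g x).
Proof.
move=> ig; rewrite (_ : (fun _ => _) = fun x => (-1) * g x).
  apply: cintegrableM ig => //.
  by exists 1 => x; rewrite sqnN /sqn /= expr0n/= addr0 expr1n.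
by apply/funext => x; rewrite mulN1r.
Qed.

Lemma measurable_Rintegral_lebesgue (f : Rn * Rn -> R) : measurable_fun setT f ->
  measurable_fun setT (fun x => \int[mu]_y f (x, y)).
Proof.
move=> /(measurable_fun_Rintegral_snd (@lebesgue_sf R N)).
by rewrite (_ : (fun x => _) = fun x => \int[mu]_y f (x, y)).
Qed.

Lemma cmeasurable_adjoint_fourier g : cintegrable g -> cmeasurable (adjoint_fourier g).
Proof.
move=> /cintegrable_measurable[rg ig].
have mc : measurable_fun setT (fun z : Rn * Rn => cos (dotp z.1 z.2)).
  by apply: measurable_cos_comp; exact: measurable_dotp.
have ms : measurable_fun setT (fun z : Rn * Rn => sin (dotp z.1 z.2)).
  apply: (measurableT_comp (f := @sin R)); last exact: measurable_dotp.
  exact: continuous_measurable_fun (@continuous_sin R).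
have m2 (f : Rn -> R) : measurable_fun setT f ->
    measurable_fun setT (fun z : Rn * Rn => f z.2).
  by move=> mf; exact: measurableT_comp.
split; rewrite /adjoint_fourier /cintegral /=.
  apply: (measurable_Rintegral_lebesgue
    (f := fun z => complex.Re (cis (dotp z.1 z.2) * g z.2))).
  under eq_fun do rewrite ReM.
  apply: measurable_funB.
    by apply: measurable_funM; [exact: mc|exact: (m2 _ rg)].
  by apply: measurable_funM; [exact: ms|exact: (m2 _ ig)].
apply: (measurable_Rintegral_lebesgue
  (f := fun z => complex.Im (cis (dotp z.1 z.2) * g z.2))).
under eq_fun do rewrite ImM.
apply: measurable_funD.
  by apply: measurable_funM; [exact: mc|exact: (m2 _ ig)].
by apply: measurable_funM; [exact: ms|exact: (m2 _ rg)].
Qed.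

(** [fourier_cos_bound] contributes 4. Another 2 comes from squaring sums of two terms, and a last 2
    because the real and the imaginary part of the data each occur in two of the four terms. *)
Definition adjoint_const : R := 16 * (32 * pi) ^+ N.

Lemma adjoint_const_gt0 : 0 < adjoint_const.
Proof. by rewrite mulr_gt0// exprn_gt0// mulr_gt0// pi_gt0. Qed.

Lemma adjoint_const_ge0 : 0 <= adjoint_const.
Proof. exact: ltW adjoint_const_gt0. Qed.

Local Open Scope ereal_scope.

Lemma adjoint_fourier_bound_weight g : cintegrable g ->
  \int[mu]_x (weight x * sqn (adjoint_fourier g x))%:E <=
  adjoint_const%:E * \int[mu]_x (sqn (g x))%:E.
Proof.
move=> ig; have [ru iv] := ig; have [mu' mv] := cintegrable_measurable ig.
pose T (h : Rn -> R) (p : R) (x : Rn) : R :=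
  ((\int[mu]_y (cos (dotp x y + p) * h y)) ^+ 2)%R.
have mT h p : mu.-integrable setT (EFin \o h) -> measurable_fun setT (T h p).
  move=> ih; apply: measurable_funX.
  apply: (measurable_Rintegral_lebesgue
    (f := fun z => (cos (dotp z.1 z.2 + p) * h z.2)%R)).
  apply: measurable_funM.
    by apply: measurable_cos_comp; apply: measurable_funD => //; exact: measurable_dotp.
  have mh : measurable_fun setT h by apply/measurable_EFinP; exact: measurable_int ih.
  exact: measurableT_comp.
pose u x := complex.Re (g x); pose v x := complex.Im (g x).
have iC h p x : mu.-integrable setT (EFin \o h) ->
    mu.-integrable setT (fun y => (cos (dotp x y + p) * h y)%:E).
  move=> ih; apply: (integrable_boundedM (M := 1)) => //.
    by apply: measurable_cos_comp; exact: measurable_funD.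
  by move=> y; exact: cos_max.
have T0 h p x : (0 <= T h p x)%R by exact: sqr_ge0.
(* Shifting the phase by [- pi / 2] turns a cosine into a sine, so the sine parts are also instances
   of [fourier_cos_bound]. *)
pose q : R := (- (pi / 2))%R.
have pt x : (sqn (adjoint_fourier g x) <=
    2 * (T u 0 x + T v q x + (T v 0 x + T u q x)))%R.
  rewrite /sqn /adjoint_fourier /cintegral /=.
  have -> : (\int[mu]_y complex.Re (cis (dotp x y) * g y) =
      \int[mu]_y (cos (dotp x y + 0) * u y) - \int[mu]_y (cos (dotp x y + q) * v y))%R.
    rewrite -RintegralB//; [|exact: iC|exact: iC].
    by apply: eq_Rintegral => y _; rewrite ReM /= /q cosBpihalf addr0.
  have -> : (\int[mu]_y complex.Im (cis (dotp x y) * g y) =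
      \int[mu]_y (cos (dotp x y + 0) * v y) + \int[mu]_y (cos (dotp x y + q) * u y))%R.
    rewrite -RintegralD//; [|exact: iC|exact: iC].
    by apply: eq_Rintegral => y _; rewrite ImM /= /q cosBpihalf addr0.
  have key (a b c d : R) :
      ((a - b) ^+ 2 + (c + d) ^+ 2 <= 2 * (a ^+ 2 + b ^+ 2 + (c ^+ 2 + d ^+ 2)))%R.
    by have := sqr_ge0 (a + b); have := sqr_ge0 (c - d); lra.
  exact: key.
have bd h p : mu.-integrable setT (EFin \o h) ->
    \int[mu]_x (weight x * T h p x)%:E <=
    (4 * (32 * pi) ^+ N)%:E * \int[mu]_y (h y ^+ 2)%:E.
  by move=> ih; apply: (le_trans (fourier_cos_bound p ih)); rewrite mulrA -natrM.
have mwT h p : mu.-integrable setT (EFin \o h) ->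
    measurable_fun setT (fun x => (weight x * T h p x)%:E).
  move=> ih; apply/measurable_EFinP/measurable_funM; first exact: measurable_weight.
  exact: mT.
have wT0 h p x : 0 <= (weight x * T h p x)%:E.
  by rewrite lee_fin mulr_ge0// weight_ge0.
have split : \int[mu]_x (2%:E * ((weight x * T u 0 x)%:E + (weight x * T v q x)%:E +
     ((weight x * T v 0 x)%:E + (weight x * T u q x)%:E))) =
   2%:E * (\int[mu]_x (weight x * T u 0 x)%:E + \int[mu]_x (weight x * T v q x)%:E +
   (\int[mu]_x (weight x * T v 0 x)%:E + \int[mu]_x (weight x * T u q x)%:E)).
  rewrite ge0_integralZl_EFin//; last 2 first.
  - by move=> x _; rewrite !adde_ge0.
  - by repeat apply: emeasurable_funD; apply: mwT.
  congr (_ * _).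
  rewrite ge0_integralD//; last 4 first.
  - by move=> x _; rewrite adde_ge0.
  - by apply: emeasurable_funD; apply: mwT.
  - by move=> x _; rewrite adde_ge0.
  - by apply: emeasurable_funD; apply: mwT.
  by rewrite !ge0_integralD//; apply: mwT.
apply: (@le_trans _ _ (\int[mu]_x (2%:E * ((weight x * T u 0 x)%:E + (weight x * T v q x)%:E +
     ((weight x * T v 0 x)%:E + (weight x * T u q x)%:E))))).
  apply: ge0_le_integral => //.
  - by move=> x _; rewrite lee_fin mulr_ge0 ?weight_ge0 ?sqn_ge0.
  - apply/measurable_EFinP/measurable_funM; first exact: measurable_weight.
    by apply: measurable_sqn; exact: cmeasurable_adjoint_fourier.
  - by apply: measurable_funeM; repeat apply: emeasurable_funD; apply: mwT.
  move=> x _; rewrite -!EFinD -EFinM lee_fin -!mulrDr mulrCA ler_wpM2l ?weight_ge0//.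
rewrite split.
have sq : \int[mu]_x (sqn (g x))%:E =
    \int[mu]_x (u x ^+ 2)%:E + \int[mu]_x (v x ^+ 2)%:E.
  rewrite -ge0_integralD//.
  - by move=> x _; rewrite lee_fin sqr_ge0.
  - by apply/measurable_EFinP; exact: measurable_funX.
  - by move=> x _; rewrite lee_fin sqr_ge0.
  - by apply/measurable_EFinP; exact: measurable_funX.
have c0 : 0 <= (4 * (32 * pi) ^+ N)%:E :> \bar R.
  by rewrite lee_fin mulr_ge0// exprn_ge0// mulr_ge0// pi_ge0.
have i0 h : 0 <= \int[mu]_x (h x ^+ 2)%:E.
  by apply: integral_ge0 => x _; rewrite lee_fin sqr_ge0.
apply: (@le_trans _ _ (2%:E * ((4 * (32 * pi) ^+ N)%:E * \int[mu]_x (sqn (g x))%:E +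
    (4 * (32 * pi) ^+ N)%:E * \int[mu]_x (sqn (g x))%:E))).
  rewrite lee_wpmul2l// ?lee_fin// sq.
  apply: leeD; first by rewrite ge0_muleDr//; apply: leeD; exact: bd.
  by rewrite addeC ge0_muleDr//; apply: leeD; exact: bd.
rewrite -ge0_muleDl// muleA -EFinD -EFinM /adjoint_const.
by rewrite (_ : 2 * _ = 16 * (32 * pi) ^+ N)%R//; ring.
Qed.

Lemma unit_ballE : @unit_ball R N = [set x | (dotp x x < 1)%R].
Proof.
have sq (d : R) : (Num.sqrt d < 1)%R = (d < 1)%R by rewrite -{1}sqrtr1 ltr_sqrt.
by apply/seteqP; split=> x; rewrite /unit_ball /= sq.
Qed.

Lemma measurable_unit_ball : measurable (@unit_ball R N).
Proof.
have md : measurable_fun setT (fun x : Rn => dotp x x).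
  by apply: measurable_sum => i; apply: measurable_funM; exact: measurable_tnth.
rewrite unit_ballE (_ : mkset _ =
    setT `&` (fun x : Rn => dotp x x) @^-1` `]-oo, 1%R[%classic).
  by apply: md => //; exact: measurable_itv.
by apply/seteqP; split=> x /=; rewrite in_itv/=; [split|case].
Qed.

Lemma weight_ge1 (x : Rn) : unit_ball x -> (1 <= weight x)%R.
Proof.
rewrite unit_ballE /= => x1.
rewrite /weight; elim/big_ind: _ => // [a b a1 b1|i _].
  by rewrite -[leLHS]mulr1 ler_pM.
have : (tnth x i * tnth x i < 1)%R.
  apply: le_lt_trans x1; rewrite /dotp (bigD1 i)//= lerDl sumr_ge0// => j _.
  exact: sqr_ge0.
rewrite -expr2 /parabola le_max => ?; apply/orP; right; lra.
Qed.

Lemma adjoint_fourier_bound g : cintegrable g ->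
  \int[mu]_(x in @unit_ball R N) (sqn (adjoint_fourier g x))%:E <=
  adjoint_const%:E * \int[mu]_x (sqn (g x))%:E.
Proof.
move=> ig; apply: le_trans (adjoint_fourier_bound_weight ig).
have ma : measurable_fun setT (fun x => sqn (adjoint_fourier g x)).
  by apply: measurable_sqn; exact: cmeasurable_adjoint_fourier.
have mwa : measurable_fun setT (fun x => (weight x * sqn (adjoint_fourier g x))%:E).
  by apply/measurable_EFinP/measurable_funM => //; exact: measurable_weight.
apply: (@le_trans _ _ (\int[mu]_(x in @unit_ball R N) (weight x * sqn (adjoint_fourier g x))%:E)).
  apply: ge0_le_integral => //.
  - exact: measurable_unit_ball.
  - by move=> x _; rewrite lee_fin sqn_ge0.
  - by apply: measurable_funTS; exact/measurable_EFinP.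
  - exact: measurable_funTS.
  - by move=> x Bx; rewrite lee_fin ler_peMl ?sqn_ge0// weight_ge1.
apply: ge0_subset_integral => //; first exact: measurable_unit_ball.
by move=> x _; rewrite lee_fin mulr_ge0 ?weight_ge0 ?sqn_ge0.
Qed.

End complex_adjoint.

(** * Chords of the unit circle *)

Section cis_lipschitz.
Variable R : realType.
Implicit Types a b : R.

Lemma sin_le_id a : 0 <= a -> sin a <= a.
Proof.
rewrite le_eqVlt => /predU1P[<-|a0]; first by rewrite sin0.
have [c _ ] := @MVT R (@sin R) (@cos R) _ _ a0 (fun x _ => is_derive_sin x)
  (continuous_subspaceT (@continuous_sin R)).
by rewrite sin0 !subr0 => ->; rewrite ler_piMl ?cos_le1// ltW.
Qed.

(** The chord has length [2 |sin ((a - b) / 2)|]. For [|sin x| <= |x|], [sin_le_id] is used up to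
    [pi], where the sine is nonnegative; beyond, [|sin x| <= 1 <= x]. *)
Lemma sqn_cisB a b : sqn (cis a - cis b) <= (a - b) ^+ 2.
Proof.
have sq (x : R) : sin x ^+ 2 <= x ^+ 2.
  wlog x0 : x / 0 <= x.
    move=> h; have [/h//|/ltW x0] := leP 0 x.
    by have := h (- x); rewrite oppr_ge0 sinN !sqrrN; apply.
  have [xpi|xpi] := leP x pi.
    by rewrite ler_sqr ?nnegrE ?sin_ge0_pi ?x0 ?sin_le_id.
  apply: (@le_trans _ _ 1).
    by rewrite -real_normK ?num_real// expr_le1// sin_max.
  rewrite expr_ge1//; apply: le_trans (ltW xpi).
  by rewrite (le_trans _ (pi_ge2 R))// ler1n.
rewrite /sqn /=.
have -> : (cos a - cos b) ^+ 2 + (sin a - sin b) ^+ 2 = 4 * sin ((a - b) / 2) ^+ 2.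
  have e1 := cos2Dsin2 a; have e2 := cos2Dsin2 b.
  have e3 := cosB a b.
  have e4 : cos (a - b) = 1 - 2 * sin ((a - b) / 2) ^+ 2.
    rewrite [in LHS](_ : a - b = (a - b) / 2 + (a - b) / 2) ?cosD; last by field.
    by have := cos2Dsin2 ((a - b) / 2); rewrite -!expr2; lra.
  lra.
rewrite (_ : (a - b) ^+ 2 = 4 * ((a - b) / 2) ^+ 2); last by field.
by rewrite ler_wpM2l.
Qed.

Lemma sqn_cisB_le4 a b : sqn (cis a - cis b) <= 4.
Proof.
apply: le_trans (sqn_add _ _) _.
by rewrite sqnN !sqn_cis; lra.
Qed.

End cis_lipschitz.

(** * Domination by square functions *)

Section domination.
Variables (R : realType) (N : nat).
Local Notation Rn := (Rn R N).
Local Notation mu := (lebesgue R N).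
Variable h : Rn -> R[i].
Hypothesis ih : cintegrable h.
Variable sigma : Rn -> R.
Hypothesis msigma : measurable_fun setT sigma.

Definition multiplier (m : Rn -> R[i]) :=
  cmeasurable m /\ exists M, forall x, sqn (m x) <= M.

Definition mulop (m : Rn -> R[i]) : Rn -> R[i] :=
  adjoint_fourier (fun xi => m xi * h xi).

(** [Q] is a majorant on the space side and [W] its price on the frequency side. Such pairs can be
    added, scaled and enlarged in [W], so after [dominated_mulop] every estimate of an operator is
    reduced to a pointwise inequality between multipliers. *)
Definition dominated (Q W : Rn -> R) :=
  [/\ measurable_fun setT Q, measurable_fun setT W, forall x, 0 <= Q x,
      forall x, 0 <= W x &
      (\int[mu]_(x in @unit_ball R N) (Q x)%:E <=
       (adjoint_const R N)%:E * \int[mu]_x (W x * sqn (h x))%:E)%E].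

Let mh : cmeasurable h.
Proof. exact: cintegrable_measurable ih. Qed.

Let mB := @measurable_unit_ball R N.

Lemma dominated_mulop m : multiplier m ->
  dominated (fun x => sqn (mulop m x)) (fun xi => sqn (m xi)).
Proof.
move=> [mm bm]; have imh := cintegrableM mm bm ih; split.
- by apply: measurable_sqn; exact: cmeasurable_adjoint_fourier.
- exact: measurable_sqn.
- by move=> x; exact: sqn_ge0.
- by move=> x; exact: sqn_ge0.
- apply: le_trans (adjoint_fourier_bound imh) _.
  by under eq_integral do rewrite sqnM.
Qed.

Lemma dominated0 : dominated (cst 0) (cst 0).
Proof.
split=> //; rewrite /cst.
under [X in (_ * X)%E]eq_integral do rewrite mul0r.
by rewrite !integral0 mule0.
Qed.

Let mWh (W : Rn -> R) : measurable_fun setT W ->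
  measurable_fun setT (fun x => (W x * sqn (h x))%:E).
Proof. by move=> mW; apply/measurable_EFinP/measurable_funM => //; exact: measurable_sqn. Qed.

Let Wh0 (W : Rn -> R) x : (forall x, 0 <= W x) -> (0 <= (W x * sqn (h x))%:E)%E.
Proof. by move=> W0; rewrite lee_fin mulr_ge0 ?sqn_ge0. Qed.

Lemma dominatedD Q1 W1 Q2 W2 : dominated Q1 W1 -> dominated Q2 W2 ->
  dominated (fun x => Q1 x + Q2 x) (fun x => W1 x + W2 x).
Proof.
move=> [mQ1 mW1 Q10 W10 b1] [mQ2 mW2 Q20 W20 b2]; split.
- exact: measurable_funD.
- exact: measurable_funD.
- by move=> x; rewrite addr_ge0.
- by move=> x; rewrite addr_ge0.
under [leLHS]eq_integral do rewrite EFinD.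
under [X in (_ * X)%E]eq_integral do rewrite mulrDl EFinD.
rewrite ge0_integralD//; last 4 first.
- by move=> x _; rewrite lee_fin.
- by apply: measurable_funTS; exact/measurable_EFinP.
- by move=> x _; rewrite lee_fin.
- by apply: measurable_funTS; exact/measurable_EFinP.
rewrite ge0_integralD//; last 4 first.
- by move=> x _; exact: Wh0.
- exact: mWh.
- by move=> x _; exact: Wh0.
- exact: mWh.
rewrite ge0_muleDr; [exact: leeD| |].
- by apply: integral_ge0 => x _; exact: Wh0.
- by apply: integral_ge0 => x _; exact: Wh0.
Qed.

Lemma dominatedZ c Q W : 0 <= c -> dominated Q W ->
  dominated (fun x => c * Q x) (fun x => c * W x).
Proof.
move=> c0 [mQ mW Q0 W0 b]; split.
- exact: measurable_funM.
- exact: measurable_funM.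
- by move=> x; rewrite mulr_ge0.
- by move=> x; rewrite mulr_ge0.
under [leLHS]eq_integral do rewrite EFinM.
under [X in (_ * X)%E]eq_integral do rewrite -mulrA EFinM.
rewrite ge0_integralZl_EFin//; last 2 first.
- by move=> x _; rewrite lee_fin.
- by apply: measurable_funTS; exact/measurable_EFinP.
rewrite ge0_integralZl_EFin//; last 2 first.
- by move=> x _; exact: Wh0.
- exact: mWh.
by rewrite muleCA lee_wpmul2l// lee_fin.
Qed.

Lemma dominated_le (Q W W' : Rn -> R) : measurable_fun setT W' -> (forall x, W x <= W' x) ->
  dominated Q W -> dominated Q W'.
Proof.
move=> mW' WW' [mQ mW Q0 W0 b].
have W'0 x : 0 <= W' x by apply: le_trans (W0 x) (WW' x).
split=> //; apply: le_trans b _.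
rewrite lee_wpmul2l// ?lee_fin ?adjoint_const_ge0//.
apply: ge0_le_integral => //.
- by move=> x _; exact: Wh0.
- exact: mWh.
- exact: mWh.
- by move=> x _; rewrite lee_fin ler_wpM2r ?sqn_ge0.
Qed.

Lemma dominated_sum n (Q W : nat -> Rn -> R) :
  (forall i, (i < n)%N -> dominated (Q i) (W i)) ->
  dominated (fun x => \sum_(i < n) Q i x) (fun x => \sum_(i < n) W i x).
Proof.
elim: n => [|n IH] d.
  have := dominated0; congr dominated; apply/funext => x; by rewrite big_ord0.
have := dominatedD (IH (fun i ni => d i (ltnW ni))) (d n (ltnSn n)).
by congr dominated; apply/funext => x; rewrite big_ord_recr.
Qed.

Lemma mulopD m1 m2 x : multiplier m1 -> multiplier m2 ->
  mulop (fun xi => m1 xi + m2 xi) x = mulop m1 x + mulop m2 x.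
Proof.
move=> [mm1 b1] [mm2 b2]; rewrite /mulop -adjoint_fourierD.
- by congr (adjoint_fourier _ _); apply/funext => y; rewrite mulrDl.
- exact: cintegrableM.
- exact: cintegrableM.
Qed.

Definition mexp (P : pred Rn) (t : R) : Rn -> R[i] :=
  fun xi => if P xi then cis (t * sigma xi) else 0.

Definition mdiff (P : pred Rn) (t u : R) : Rn -> R[i] :=
  fun xi => if P xi then cis (t * sigma xi) - cis (u * sigma xi) else 0.

Definition measurable_pred (P : pred Rn) := measurable [set xi | P xi].

Lemma measurable_fun_pred P : measurable_pred P -> measurable_fun setT P.
Proof.
move=> mP; apply: (measurable_fun_bool true); rewrite setTI.
by rewrite (_ : _ @^-1` _ = [set xi | P xi])//; apply/seteqP; split.
Qed.

Lemma multiplier_if P m : measurable_pred P -> multiplier m ->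
  multiplier (fun xi => if P xi then m xi else 0).
Proof.
move=> /measurable_fun_pred mP [[mr mi] [M mM]]; split.
  split.
    rewrite (_ : (fun _ => _) = fun x => if P x then complex.Re (m x) else 0).
      exact: measurable_fun_ifT.
    by apply/funext => x; case: (P x).
  rewrite (_ : (fun _ => _) = fun x => if P x then complex.Im (m x) else 0).
    exact: measurable_fun_ifT.
  by apply/funext => x; case: (P x).
exists M => x; case: ifPn => // _; rewrite sqn0.
exact: le_trans (sqn_ge0 _) (mM x).
Qed.

Let mcis t : cmeasurable (fun xi => cis (t * sigma xi)).
Proof. by apply: cmeasurable_cis; exact: measurable_funM. Qed.

Lemma multiplier_mexp P t : measurable_pred P -> multiplier (mexp P t).
Proof.
move=> mP; apply: multiplier_if => //; split=> //.
by exists 1 => x; rewrite sqn_cis.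
Qed.

Lemma multiplier_mdiff P t u : measurable_pred P -> multiplier (mdiff P t u).
Proof.
move=> mP; apply: multiplier_if => //; split.
  apply: cmeasurableD => //.
  rewrite (_ : (fun x => _) = fun x => (-1) * cis (u * sigma x)).
    exact: cmeasurableM.
  by apply/funext => x; rewrite mulN1r.
by exists 4 => x; exact: sqn_cisB_le4.
Qed.

(** One link of a telescoping chain of times. *)
Lemma mulop_mdiff_split P t u v x : measurable_pred P ->
  mulop (mdiff P t v) x = mulop (mdiff P t u) x + mulop (mdiff P u v) x.
Proof.
move=> mP; rewrite -mulopD; [|exact: multiplier_mdiff|exact: multiplier_mdiff].
congr (adjoint_fourier _ _); apply/funext => y; congr (_ * _).
by rewrite /mdiff; case: ifPn => _; rewrite ?addr0// addrA subrK.
Qed.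

End domination.

(** * Chaining along dyadic times *)

Section dyadic_grid.
Variable R : realType.
Implicit Types t : R.

Definition grid (j : nat) t : R := (Num.truncn (t * 2 ^+ j))%:R / 2 ^+ j.

Let exp2_gt0 j : 0 < 2 ^+ j :> R. Proof. by rewrite exprn_gt0. Qed.

(** The grids are nested: the coarser approximation of [t] is determined by the finer one. The links
    between two consecutive levels are therefore indexed by a single integer, whatever the number of
    times. *)
Lemma truncn_half j t : 0 <= t ->
  (Num.truncn (t * 2 ^+ j.+1))./2 = Num.truncn (t * 2 ^+ j).
Proof.
move=> t0; apply/esym/truncn_def.
have y0 : 0 <= t * 2 ^+ j.+1 by rewrite mulr_ge0// ltW.
have /andP[] := truncn_itv y0.
set q := Num.truncn (t * 2 ^+ j.+1) => q1 q2.
have q3 : q%:R = (odd q)%:R + 2 * (q./2)%:R :> R.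
  by rewrite -[in LHS](odd_double_half q) natrD -muln2 natrM mulrC.
have o0 : 0 <= (odd q)%:R :> R by [].
have o1 : (odd q)%:R <= 1 :> R by rewrite lern1 leq_b1.
move: q1 q2; rewrite -[q.+1%:R]natr1 -[(q./2).+1%:R]natr1 q3 exprS mulrCA => q1 q2.
by apply/andP; split; lra.
Qed.

Lemma grid_bounds j t : 0 <= t -> 0 <= t - grid j t <= (2 ^+ j)^-1.
Proof.
move=> t0; have /andP[] := truncn_itv (mulr_ge0 t0 (ltW (exp2_gt0 j))).
rewrite /grid -[(Num.truncn _).+1%:R]natr1 => q1 q2; apply/andP; split.
  by rewrite subr_ge0 ler_pdivrMr.
by rewrite lerBlDr -[X in X + _]mul1r -mulrDl ler_pdivlMr// addrC ltW.
Qed.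

End dyadic_grid.

Section chaining.
Variables (R : realType) (N : nat).
Local Notation Rn := (Rn R N).
Variable h : Rn -> R[i].
Hypothesis ih : cintegrable h.
Variable sigma : Rn -> R.
Hypothesis msigma : measurable_fun setT sigma.
Variables (P : pred Rn) (k : nat) (b : R).
Hypothesis mP : measurable_pred P.
Hypothesis sigmaP : forall xi, P xi -> `|sigma xi| <= 2 ^+ k.+1.
Hypothesis b0 : 0 < b.

Let D t u x := sqn (mulop h (mdiff sigma P t u) x).
Let ind xi : R := (P xi)%:R.

Let exp2_gt0 j : 0 < 2 ^+ j :> R. Proof. by rewrite exprn_gt0. Qed.

Let mind c : measurable_fun setT (fun xi => c * ind xi).
Proof.
apply: measurable_funM => //.
rewrite (_ : ind = fun x => if P x then 1 else 0).
  by apply: measurable_fun_ifT => //; exact: measurable_fun_pred.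
by apply/funext => x; rewrite /ind; case: (P x).
Qed.

Let sqn_mdiff_le d t u xi : `|t - u| <= d ->
  sqn (mdiff sigma P t u xi) <= (d * 2 ^+ k.+1) ^+ 2 * ind xi.
Proof.
move=> tu; rewrite /mdiff /ind; case: ifPn => Pxi; last by rewrite sqn0 mulr0.
rewrite mulr1; apply: le_trans (sqn_cisB _ _) _.
rewrite -mulrBl -real_normK ?num_real// normrM.
have d0 : 0 <= d by apply: le_trans tu.
by rewrite ler_sqr ?nnegrE ?mulr_ge0// ?ler_pM// ?sigmaP// ltW.
Qed.

Let sqn_mdiff_le4 t u xi : sqn (mdiff sigma P t u xi) <= 4 * ind xi.
Proof.
rewrite /mdiff /ind; case: ifPn => Pxi; last by rewrite sqn0 mulr0.
by rewrite mulr1 sqn_cisB_le4.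
Qed.

Let dominated_D t u : dominated h (D t u) (fun xi => sqn (mdiff sigma P t u xi)).
Proof. by apply: dominated_mulop => //; exact: multiplier_mdiff. Qed.

(** Splitting at [t] itself gives [z = z + z]. *)
Lemma dominated_D_refl t x : D t t x = 0.
Proof.
rewrite /D; have := mulop_mdiff_split ih msigma t t t x mP.
set z := mulop _ _ _ => /eqP; rewrite -subr_eq subrr eq_sym => /eqP ->.
by rewrite sqn0.
Qed.

(** With [j = k + i] there are at most [b 2^(j+1)] links, each joining times at distance at most
    [2^-(j+1)]. As [|sigma| <= 2^(k+1)] on [P], one link costs [2^(-2i)], and all of them
    [2 b 2^k 2^-i]. *)
Let increment i : exists2 Q, dominated h Q (fun xi => 2 * b * 2 ^+ k * 2^-1 ^+ i * ind xi) &
  forall t, 0 <= t <= b -> forall x, D (grid (k + i).+1 t) (grid (k + i) t) x <= Q x.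
Proof.
set j := (k + i)%N; pose n := Num.truncn (b * 2 ^+ j.+1).
pose W xi := (2^-1 ^+ i) ^+ 2 * ind xi.
(* Only nonzero nodes are counted, since the link at node 0 is trivial. Thus their number is at most
   [b 2^(j+1)], without an added 1 that would spoil the proportionality to [b] for short
   intervals. *)
pose Q (q : nat) := D (q.+1%:R / 2 ^+ j.+1) ((q.+1)./2%:R / 2 ^+ j).
exists (fun x => \sum_(q < n) Q q x).
  apply: (@dominated_le _ _ _ ih _ (fun xi => \sum_(q < n) W xi)) => //.
    move=> xi; rewrite sumr_const card_ord /W -[_ *+ n]mulr_natl mulrA ler_wpM2r//.
    rewrite -[leRHS]mulr1.
    have n1 : n%:R <= b * 2 ^+ j.+1 by rewrite truncn_le mulr_ge0// ltW.
    apply: le_trans (ler_wpM2r _ n1) _; first by rewrite sqr_ge0.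
    have uv : 2 ^+ i * 2^-1 ^+ i = 1 :> R by rewrite -exprMn mulfV ?expr1n.
    rewrite /j exprS exprD le_eqVlt; apply/orP; left; apply/eqP.
    rewrite [LHS](_ : _ = 2 * b * 2 ^+ k * 2^-1 ^+ i * (2 ^+ i * 2^-1 ^+ i)).
      by rewrite uv mulr1.
    by ring.
  apply: (@dominated_sum _ _ _ ih n Q (fun _ => W)) => q _.
  apply: (dominated_le ih _ _ (dominated_D _ _)); first exact: mind.
  move=> xi; apply: le_trans (sqn_mdiff_le (d := (2 ^+ j.+1)^-1) _ _) _.
    have q3 : q.+1%:R = (odd q.+1)%:R + 2 * ((q.+1)./2)%:R :> R.
      by rewrite -[in LHS](odd_double_half q.+1) natrD -muln2 natrM mulrC.
    rewrite [X in `|X|](_ : _ = (odd q.+1)%:R / 2 ^+ j.+1).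
      have e0 : 0 <= (2 ^+ j.+1)^-1 :> R by rewrite invr_ge0 ltW.
      rewrite normrM (ger0_norm e0) ler_piMl//.
      by rewrite ger0_norm// lern1 leq_b1.
    by rewrite q3 exprS; field; rewrite ?expf_neq0.
  rewrite /W ler_wpM2r//.
  rewrite (_ : _ * _ = 2^-1 ^+ i)//.
  by rewrite /j -addSn exprD invfM mulrAC mulVf ?expf_neq0// mul1r exprVn.
move=> t /andP[t0 tb] x.
rewrite /grid -(truncn_half j t0).
case qE : (Num.truncn (t * 2 ^+ j.+1)) => [|q].
  by rewrite /= mulr0n !mul0r dominated_D_refl sumr_ge0// => q _; exact: sqn_ge0.
have qn : (q < n)%N.
  rewrite -qE; apply: le_truncn.
  by rewrite ler_wpM2r// ltW.
by rewrite (bigD1 (Ordinal qn))//= lerDl sumr_ge0// => p _; exact: sqn_ge0.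
Qed.

(** A step of length [2^-k] already changes the phase by up to 2, so coarser levels would gain
    nothing. The at most [b 2^k] nonzero nodes are compared with time 0 directly, at the trivial
    cost 4 each. *)
Let increment0 : exists2 Q, dominated h Q (fun xi => 4 * b * 2 ^+ k * ind xi) &
  forall t, 0 <= t <= b -> forall x, D (grid k t) 0 x <= Q x.
Proof.
pose n := Num.truncn (b * 2 ^+ k).
pose Q (q : nat) := D (q.+1%:R / 2 ^+ k) 0.
exists (fun x => \sum_(q < n) Q q x).
  apply: (@dominated_le _ _ _ ih _ (fun xi => \sum_(q < n) (4 * ind xi))) => //.
    move=> xi; rewrite sumr_const card_ord -[_ *+ n]mulr_natl mulrA ler_wpM2r//.
    by rewrite mulrC -mulrA ler_wpM2l// truncn_le mulr_ge0// ltW.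
  apply: (@dominated_sum _ _ _ ih n Q (fun _ xi => 4 * ind xi)) => q _.
  apply: (dominated_le ih _ _ (dominated_D _ _)); first exact: mind.
  by move=> xi; exact: sqn_mdiff_le4.
move=> t /andP[t0 tb] x; rewrite /grid.
case qE : (Num.truncn (t * 2 ^+ k)) => [|q].
  by rewrite mul0r dominated_D_refl sumr_ge0// => q _; exact: sqn_ge0.
have qn : (q < n)%N.
  by rewrite -qE; apply: le_truncn; rewrite ler_wpM2r// ltW.
by rewrite (bigD1 (Ordinal qn))//= lerDl sumr_ge0// => p _; exact: sqn_ge0.
Qed.

(** The constant is the fixed point of the recursion from [sqn_addw]: [c = 4 * 2 + 4/3 * c/2] gives
    [c = 24], uniformly in the length [n] of the chain. *)
Let chain n i : exists2 Q, dominated h Q (fun xi => 24 * b * 2 ^+ k * 2^-1 ^+ i * ind xi) &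
  forall t, 0 <= t <= b -> forall x, D (grid (k + i + n) t) (grid (k + i) t) x <= Q x.
Proof.
elim: n i => [|n IH] i.
  exists (cst 0) => [|t _ x]; last by rewrite addn0 dominated_D_refl.
  apply: (dominated_le ih _ _ (dominated0 h)); first exact: mind.
  by move=> xi; rewrite !mulr_ge0// ?exprn_ge0// ltW.
have [Q1 dQ1 Q1b] := increment i.
have [Q2 dQ2 Q2b] := IH i.+1.
exists (fun x => 4 * Q1 x + 4 / 3 * Q2 x).
  apply: dominated_le (dominatedD ih (dominatedZ ih _ dQ1) (dominatedZ ih _ dQ2)) => //.
  move=> xi; rewrite le_eqVlt; apply/orP; left; apply/eqP.
  by rewrite exprS; field.
move=> t tb x; rewrite /D.
rewrite (mulop_mdiff_split ih msigma _ (grid (k + i).+1 t) _ x mP) addrC.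
apply: le_trans (sqn_addw _ _) _; apply: lerD; apply: ler_wpM2l => //.
  exact: Q1b.
by have := Q2b t tb x; rewrite addnS addSnnS.
Qed.

(** This ends the chain at a finite level. A single time is missed by at most [2^-(k+J)], at cost
    [4 * 4^-J]; [J] is chosen so large that [n <= b 2^k 2^J], and the sum over all [n] times stays
    below [4 b 2^k]. *)
Let residual (ts : seq R) : (forall t, t \in ts -> 0 <= t <= b) ->
  exists J, exists2 Q, dominated h Q (fun xi => 4 * b * 2 ^+ k * ind xi) &
  forall t, t \in ts -> forall x, D t (grid (k + J) t) x <= Q x.
Proof.
move=> tsb; pose n := size ts.
pose J := (Num.truncn (n%:R / (b * 2 ^+ k))).+1; exists J.
pose Q (i : nat) := D (nth 0 ts i) (grid (k + J) (nth 0 ts i)).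
pose W xi := ((2 ^+ (k + J))^-1 * 2 ^+ k.+1) ^+ 2 * ind xi.
have bk0 : 0 < b * 2 ^+ k by rewrite mulr_gt0.
have nJ : n%:R <= b * 2 ^+ k * 2 ^+ J.
  rewrite -ler_pdivrMl// mulrC; apply: ltW.
  apply: lt_le_trans (truncnS_gt _) _.
  by rewrite -[leRHS]natrX ler_nat ltnW// ltn_expl.
exists (fun x => \sum_(i < n) Q i x).
  apply: (@dominated_le _ _ _ ih _ (fun xi => \sum_(q < n) W xi)) => //.
    move=> xi; rewrite sumr_const card_ord /W -[_ *+ n]mulr_natl mulrA ler_wpM2r//.
    have J1 : 2 ^- J <= 1 :> R by rewrite invf_le1// exprn_ege1// ler1n.
    have -> : (2 ^+ (k + J))^-1 * 2 ^+ k.+1 = 2 * 2 ^- J :> R.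
      by rewrite exprD exprS invfM; field; rewrite !expf_neq0.
    apply: le_trans (ler_wpM2r _ nJ) _; first by rewrite sqr_ge0.
    rewrite (_ : b * 2 ^+ k * 2 ^+ J * (2 * 2 ^- J) ^+ 2 = 4 * b * 2 ^+ k * 2 ^- J).
      by rewrite ler_piMr// mulr_ge0// ?mulr_ge0// ltW.
    by field; rewrite expf_neq0.
  apply: (@dominated_sum _ _ _ ih n Q (fun _ => W)) => i ni.
  apply: (dominated_le ih _ _ (dominated_D _ _)); first exact: mind.
  move=> xi; apply: sqn_mdiff_le.
  have /andP[t0 _] := tsb _ (mem_nth 0 ni).
  by have /andP[d0 d1] := grid_bounds (k + J) t0; rewrite ger0_norm.
move=> t tts x; have it : (index t ts < n)%N by rewrite index_mem.
rewrite (bigD1 (Ordinal it))//= /Q nth_index// lerDl sumr_ge0// => p _.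
exact: sqn_ge0.
Qed.

(** The path from [t] to 0 is cut at levels [k + J] and [k]. The two uses of [sqn_addw] give
    [80 = 4 * 4 + 4/3 * (4 * 4 + 4/3 * 24)]. *)
Lemma dominated_shell (ts : seq R) : (forall t, t \in ts -> 0 <= t <= b) ->
  exists2 Q, dominated h Q (fun xi => 80 * b * 2 ^+ k * (P xi)%:R) &
  forall t, t \in ts -> forall x, sqn (mulop h (mdiff sigma P t 0) x) <= Q x.
Proof.
move=> tsb; have [Q1 dQ1 Q1b] := increment0.
have [J [Q3 dQ3 Q3b]] := residual tsb.
have [Q2 dQ2 Q2b] := chain J 0.
exists (fun x => 4 * Q1 x + 4 / 3 * (4 * Q3 x + 4 / 3 * Q2 x)).
  apply: dominated_le (dominatedD ih (dominatedZ ih _ dQ1) (dominatedZ ih _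
    (dominatedD ih (dominatedZ ih _ dQ3) (dominatedZ ih _ dQ2)))) => //.
  move=> xi; rewrite le_eqVlt; apply/orP; left; apply/eqP.
  by rewrite expr0 /ind; field.
move=> t tts x; have tb := tsb t tts.
rewrite (mulop_mdiff_split ih msigma _ (grid k t) _ x mP) addrC.
apply: le_trans (sqn_addw _ _) _; apply: lerD; apply: ler_wpM2l => //.
  exact: Q1b.
rewrite (mulop_mdiff_split ih msigma _ (grid (k + J) t) _ x mP).
apply: le_trans (sqn_addw _ _) _; apply: lerD; apply: ler_wpM2l => //.
  exact: Q3b.
by have := Q2b t tb x; rewrite addn0.
Qed.

End chaining.

(** * Summation over the frequency scales *)

Section frequency_scales.
Variables (R : realType) (N : nat).
Local Notation Rn := (Rn R N).

Definition rho (xi : Rn) : R := 1 + dotp xi xi.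
Definition low (K : nat) : pred Rn := fun xi => rho xi < 2 ^+ K.
Definition shell (K : nat) : pred Rn := fun xi => (2 ^+ K <= rho xi) && (rho xi < 2 ^+ K.+1).

Lemma dotp_ge0 (xi : Rn) : 0 <= dotp xi xi.
Proof. by apply: sumr_ge0 => i _; exact: sqr_ge0. Qed.

Lemma rho_ge1 xi : 1 <= rho xi.
Proof. by rewrite lerDl dotp_ge0. Qed.

Lemma measurable_rho : measurable_fun setT rho.
Proof.
apply: measurable_funD => //.
by apply: measurable_sum => i; apply: measurable_funM; exact: measurable_tnth.
Qed.

Lemma measurable_pred_low K : measurable_pred (low K).
Proof.
rewrite /measurable_pred /low (_ : mkset _ = setT `&` rho @^-1` `]-oo, 2 ^+ K[%classic).
  by apply: measurable_rho => //; exact: measurable_itv.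
by apply/seteqP; split=> x /=; rewrite in_itv/=; [split|case].
Qed.

Lemma measurable_pred_neg (P : pred Rn) : measurable_pred P -> measurable_pred (fun xi => ~~ P xi).
Proof.
move=> mP; rewrite /measurable_pred (_ : mkset _ = ~` [set xi | P xi]); first exact: measurableC.
by apply/seteqP; split=> x /= /negP.
Qed.

Lemma measurable_pred_T : measurable_pred (fun _ : Rn => true).
Proof. by rewrite /measurable_pred (_ : mkset _ = setT)//; apply/seteqP; split. Qed.

Lemma measurable_pred_shell K : measurable_pred (shell K).
Proof.
rewrite /measurable_pred (_ : mkset _ = ~` [set xi | low K xi] `&` [set xi | low K.+1 xi]).
  by apply: measurableI; [apply: measurableC|]; exact: measurable_pred_low.
apply/seteqP; split=> x /=; rewrite /shell /low leNgt.
  by move=> /andP[/negP].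
by move=> [/negP-> ->].
Qed.

Lemma low_mono K xi : low K xi -> low K.+1 xi.
Proof. by rewrite /low => /lt_le_trans; apply; rewrite exprS ler_peMl ?exprn_ge0// ler1n. Qed.

Lemma lowS K xi : low K.+1 xi = shell K xi || low K xi.
Proof.
rewrite /shell -/(low K.+1 xi); case: (boolP (low K xi)) => [lK|].
  by rewrite low_mono// orbT.
by rewrite /low -leNgt => ->; rewrite orbF.
Qed.

Lemma shell_low K xi : shell K xi -> low K xi = false.
Proof. by rewrite /shell /low leNgt => /andP[/negbTE->]. Qed.

(** The price, per unit of time, of all shells below [2^K], as produced by [dominated_low]: peeling
    off the top shell costs [4 * 80] there and multiplies the price of the rest by [4/3]. *)
Fixpoint shell_weight (K : nat) (xi : Rn) : R :=
  if K is K'.+1 then 320 * 2 ^+ K' * (shell K' xi)%:R + 4 / 3 * shell_weight K' xi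
  else 0.

Lemma measurable_shell_weight K : measurable_fun setT (shell_weight K).
Proof.
elim: K => [|K IH] //=; apply: measurable_funD; apply: measurable_funM => //.
rewrite (_ : (fun _ => _) = fun x => if shell K x then 1 else 0).
  by apply: measurable_fun_ifT => //; (apply: measurable_fun_pred; exact: measurable_pred_shell).
by apply/funext => x; case: shell.
Qed.

Lemma shell_weight_ge0 K xi : 0 <= shell_weight K xi.
Proof. by elim: K => [|K IH] //=; rewrite addr_ge0// mulr_ge0// mulr_ge0// exprn_ge0. Qed.

(* Abel summation: with [S_n] the left-hand sum and [G_n] its general term,
   [(1 - 4a/3) S_n + G_n] only grows by the shell contributions. *)
Lemma sum_shell_weight (a : R) n xi : 0 < a ->
  (1 - 4 / 3 * a) * \sum_(K < n) a ^+ K * shell_weight K xi +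
    a ^+ n * shell_weight n xi =
  320 * a * \sum_(K < n) (2 * a) ^+ K * (shell K xi)%:R.
Proof.
move=> a0; elim: n => [|n IH]; first by rewrite !big_ord0 /= !mulr0 addr0.
by rewrite !big_ord_recr/= !mulrDr -IH exprS exprMn; field.
Qed.

(** The shells are disjoint, so at most one term is nonzero. The factor [low n] carries this through
    the induction: on shell [n] it is 0, and hence so is the bound on the earlier terms. *)
Lemma sum_shell (c : R) (F : R) n xi : 0 <= F ->
  (forall K, shell K xi -> c ^+ K <= F) ->
  \sum_(K < n) c ^+ K * (shell K xi)%:R <= F * (low n xi)%:R.
Proof.
move=> F0 cF; elim: n => [|n IH].
  by rewrite big_ord0 mulr_ge0.
rewrite big_ord_recr/= lowS; case: (boolP (shell n xi)) => [sn|_] /=.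
  move: IH; rewrite (shell_low sn) mulr0 !mulr1 => IH.
  by rewrite -[leRHS]add0r lerD// cF.
by rewrite mulr0 addr0.
Qed.

End frequency_scales.

(** * The maximal estimate for integrable frequency data and finitely many times *)

Section maximal_estimate.
Variables (R : realType) (N : nat).
Local Notation Rn := (Rn R N).
Variable sigma : Rn -> R.
Hypothesis msigma : measurable_fun setT sigma.
Hypothesis sigma_le : forall xi, `|sigma xi| <= dotp xi xi.
Variable s : R.
Hypotheses (s0 : 0 < s) (s1 : s < 1 / 2).
Variables (t : nat -> R) (Cw : R).
Hypothesis t0 : forall n, 0 <= t n.
Hypothesis Cw0 : 0 <= Cw.
Hypothesis tw : forall M x, 1 <= x ->
  \sum_(n < M) (x `^ (s - 1) <= t n)%R%:R <= Cw * x `^ s.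

Let a : R := 2 `^ (s - 1).

Let a_gt0 : 0 < a. Proof. exact: powR_gt0. Qed.

(** This is where [s < 1/2] enters: it gives [a^2 <= 1/2 < 9/16]. It makes [theta] positive, so that
    the sum over the scales converges. *)
Let a_lt : a < 3 / 4.
Proof.
have : a ^+ 2 <= 2^-1.
  rewrite -powR_mulrn ?(ltW a_gt0)// /a -powRrM -[leRHS]powR_inv1//.
  by apply: ler_powR; [rewrite ler1n|move: s1; lra].
by have := a_gt0; nra.
Qed.

Let theta : R := 1 - 4 / 3 * a.
Let theta_gt0 : 0 < theta. Proof. by rewrite /theta; have := a_lt; lra. Qed.

(** The three terms pay for [T_0], for the high and for the low frequencies: [4 * 1], then
    [4/3 * 4 * 4 Cw], where one 4 bounds a squared chord, then [4/3 * 4/3 * 320 / theta]. *)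
Definition maximal_const : R := 4 + 64 / 3 * Cw + 16 / 9 * (320 / theta).

Lemma maximal_const_ge0 : 0 <= maximal_const.
Proof. by rewrite !addr_ge0// mulr_ge0// divr_ge0// ltW. Qed.

Let sigma_shell K xi : shell K xi -> `|sigma xi| <= 2 ^+ K.+1.
Proof.
move=> /andP[_ /ltW]; apply: le_trans; apply: le_trans (sigma_le xi) _.
by rewrite /rho lerDr.
Qed.

Lemma powR2X (r : R) K : (2 ^+ K) `^ r = (2 `^ r) ^+ K :> R.
Proof.
elim: K => [|K IH]; first by rewrite !expr0 powR1.
by rewrite !exprS powRM ?exprn_ge0// IH.
Qed.

Lemma sum_shell_weight_le n (xi : Rn) :
  \sum_(K < n) a ^+ K / a * shell_weight K xi <= 320 / theta * rho xi `^ s.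
Proof.
have a2 : 2 * a = 2 `^ s by rewrite /a mulr_powRB1.
have F0 : 0 <= rho xi `^ s by exact: powR_ge0.
have h1 := @sum_shell R N (2 * a) (rho xi `^ s) n xi F0.
have {}h1 : \sum_(K < n) (2 * a) ^+ K * (shell K xi)%:R <= rho xi `^ s.
  apply: le_trans (h1 _) _ => [K /andP[Kr _]|]; last by rewrite ler_piMr// lern1 leq_b1.
  rewrite a2 -powR2X; apply: ge0_ler_powR => //; rewrite ?nnegrE ?exprn_ge0//.
    exact: ltW.
  by apply: le_trans (rho_ge1 xi).
have h2 := sum_shell_weight n xi a_gt0.
under eq_bigr do rewrite mulrAC.
rewrite -mulr_suml.
set S := \sum_(i < n) _ in h2 *.
have V0 : 0 <= a ^+ n * shell_weight n xi.
  by rewrite mulr_ge0 ?shell_weight_ge0// exprn_ge0// (ltW a_gt0).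
rewrite ler_pdivrMr// -(ler_pM2l theta_gt0).
rewrite (_ : theta * (320 / theta * rho xi `^ s * a) = 320 * a * rho xi `^ s); last first.
  by field; rewrite gt_eqF.
have : 320 * a * \sum_(K < n) (2 * a) ^+ K * (shell K xi)%:R <= 320 * a * rho xi `^ s.
  by rewrite ler_wpM2l// mulr_ge0// ltW.
move: h2; rewrite -/theta; move: V0; lra.
Qed.

(** Minimality of [K] gives the upper bound on [t n]; for [K = 0] there is none, as the times need
    not be small. Positivity is a premise inside the quantifier so that [choice] assigns a scale to
    every index. *)
Let scale_ex n : exists K, 0 < t n ->
  a ^+ K <= t n /\ ((0 < K)%N -> t n <= a ^+ K / a).
Proof.
have [tn0|] := ltP 0 (t n); last by exists 0%N.
have a1 : `|a| < 1 by rewrite ger0_norm ?(ltW a_gt0)//; have := a_lt; lra.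
have /cvgr0Pnorm_lt/(_ (t n) tn0)[K0 _ /(_ K0 (leqnn K0))/=] := cvg_expr a1.
rewrite ger0_norm ?exprn_ge0 ?(ltW a_gt0)// => aK0.
have ex : exists K, a ^+ K <= t n by exists K0; exact: ltW.
exists (ex_minn ex) => _; case: ex_minnP => K aK minK; split=> // K_gt0.
rewrite -(prednK K_gt0) exprS mulrAC divff ?gt_eqF// mul1r leNgt.
by apply/negP => /ltW/minK; rewrite leqNgt ltn_predL K_gt0.
Qed.

Variable h : Rn -> R[i].
Hypothesis ih : cintegrable h.

Let D P u x := sqn (mulop h (mdiff sigma P u 0) x).

(** Induction that peels off the top shell. No bound on the times is asked for when [K = 0], because
    [rho >= 1] makes [low 0] empty. *)
Let dominated_low K b (ts : seq R) : 0 < b ->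
  ((0 < K)%N -> forall u, u \in ts -> 0 <= u <= b) ->
  exists2 Q, dominated h Q (fun xi => b * shell_weight K xi) &
  forall u, u \in ts -> forall x, D (low K) u x <= Q x.
Proof.
move=> b0; elim: K => [|K IH] tsb.
  exists (cst 0).
    apply: (dominated_le ih _ _ (dominated0 h)) => //.
      by apply: measurable_funM => //; exact: measurable_shell_weight.
    by move=> xi /=; rewrite mulr0.
  move=> u _ x; rewrite /D (_ : mdiff _ _ _ _ = mdiff sigma (@low R N 0) 0 0).
    by rewrite (dominated_D_refl ih msigma (measurable_pred_low 0)).
  apply/funext => xi; rewrite /mdiff /low expr0 ltNge rho_ge1//.
have {}tsb := tsb isT.
have [Q2 dQ2 Q2b] := IH (fun _ => tsb).
have [Q1 dQ1 Q1b] := dominated_shell ih msigma (@measurable_pred_shell R N K)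
  (@sigma_shell K) b0 tsb.
exists (fun x => 4 * Q1 x + 4 / 3 * Q2 x).
  apply: dominated_le (dominatedD ih (dominatedZ ih _ dQ1) (dominatedZ ih _ dQ2)) => //.
    by apply: measurable_funM => //; exact: measurable_shell_weight.
  move=> xi; rewrite le_eqVlt; apply/orP; left; apply/eqP => /=.
  by field.
move=> u uts x; rewrite /D (_ : mdiff sigma (low K.+1) u 0 =
    fun xi => mdiff sigma (shell K) u 0 xi + mdiff sigma (low K) u 0 xi).
  rewrite mulopD//; last 2 first.
  - (by apply: multiplier_mdiff => //; exact: measurable_pred_shell).
  - (by apply: multiplier_mdiff => //; exact: measurable_pred_low).
  apply: le_trans (sqn_addw _ _) _; apply: lerD; apply: ler_wpM2l => //.
    exact: Q1b.
  exact: Q2b.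
apply/funext => xi; rewrite /mdiff lowS.
case: (boolP (shell K xi)) => [sK|_]; last by rewrite add0r.
by rewrite (shell_low sK) addr0.
Qed.

(** All times of scale [K > 0] lie in [[0, a^K / a]], so one application of [dominated_low] serves
    them together, however many they are. Only the distinct scales are summed. *)
Let dominated_lows (kap : nat -> nat) M n :
  (forall i, 0 < t i ->
    a ^+ kap i <= t i /\ ((0 < kap i)%N -> t i <= a ^+ kap i / a)) ->
  exists2 Q, dominated h Q (fun xi => \sum_(K < n) a ^+ K / a * shell_weight K xi) &
  forall i, (i < M)%N -> 0 < t i -> (kap i < n)%N ->
    forall x, D (low (kap i)) (t i) x <= Q x.
Proof.
move=> hkap; elim: n => [|n [Q1 dQ1 Q1b]].
  exists (cst 0) => //.
  by have := dominated0 h; congr dominated; apply/funext => x; rewrite big_ord0.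
pose ts := [seq t i | i <- iota 0 M & (0 < t i) && (kap i == n)].
have [||Q2 dQ2 Q2b] := @dominated_low n (a ^+ n / a) ts.
- by rewrite divr_gt0// exprn_gt0.
- move=> n0 u /mapP[j]; rewrite mem_filter => /andP[/andP[tj /eqP kn] _] ->.
  have [_] := hkap j tj; rewrite kn => /(_ n0) ->.
  by rewrite (ltW tj).
exists (fun x => Q1 x + Q2 x).
  have := dominatedD ih dQ1 dQ2; congr dominated.
  by apply/funext => xi; rewrite big_ord_recr.
have [_ _ Q10 _ _] := dQ1; have [_ _ Q20 _ _] := dQ2.
move=> i iM ti; rewrite ltnS leq_eqVlt => /predU1P[kn|kn] x.
  rewrite -[leLHS]add0r lerD// kn; apply: Q2b.
  by apply: map_f; rewrite mem_filter ti kn eqxx mem_iota.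
by rewrite -[leLHS]addr0 lerD// Q1b.
Qed.

Lemma maximal_dominated M : exists2 Q,
  dominated h Q (fun xi => maximal_const * rho xi `^ s) &
  forall n, (n < M)%N -> forall x,
    sqn (mulop h (mexp sigma (fun=> true) (t n)) x) <= Q x.
Proof.
have [kap hkap] := choice scale_ex.
pose n := (\max_(i < M) (kap i)).+1.
have [Ql dQl Qlb] := dominated_lows M n hkap.
(* The condition [0 < t i] is built in because [kap i] is arbitrary when [t i = 0], and such an
   index could not be charged to the counting hypothesis [tw]. *)
pose hi i : pred Rn := fun xi => ~~ low (kap i) xi && (0 < t i).
pose Qh (i : nat) x := D (hi i) (t i) x.
have mhi i : measurable_pred (hi i).
  rewrite /hi; case: (0 < t i).
    by under eq_fun do rewrite andbT; (apply: measurable_pred_neg; exact: measurable_pred_low).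
  under eq_fun do rewrite andbF.
  by rewrite /measurable_pred (_ : mkset _ = set0)//; apply/seteqP; split.
pose Q0 x := sqn (mulop h (mexp sigma (fun=> true) 0) x).
have dQ0 : dominated h Q0 (fun xi => sqn (mexp sigma (fun=> true) 0 xi)).
  by apply: dominated_mulop => //; (by apply: multiplier_mexp => //; exact: measurable_pred_T).
have dQh i : dominated h (Qh i) (fun xi => sqn (mdiff sigma (hi i) (t i) 0 xi)).
  by apply: dominated_mulop => //; exact: multiplier_mdiff.
have dQhs := @dominated_sum _ _ _ ih M Qh _ (fun i _ => dQh i).
have mrs c : measurable_fun setT (fun xi : Rn => c * rho xi `^ s).
  apply: measurable_funM => //.
  apply: (measurableT_comp (f := @powR R ^~ s)); first exact: measurable_powR.
  exact: measurable_rho.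
exists (fun x => 4 * Q0 x + 4 / 3 * (4 * (\sum_(i < M) Qh i x) + 4 / 3 * Ql x)).
  apply: dominated_le (dominatedD ih (dominatedZ ih _ dQ0) (dominatedZ ih _
    (dominatedD ih (dominatedZ ih _ dQhs) (dominatedZ ih _ dQl)))) => //.
  move=> xi; rewrite /maximal_const.
  have r1 : 1 <= rho xi `^ s.
    by rewrite -[leLHS](powRr0 (rho xi)) ler_powR ?rho_ge1// ltW.
  have b0 : sqn (mexp sigma (fun=> true) 0 xi) = 1 by rewrite /mexp sqn_cis.
  have bl := sum_shell_weight_le n xi.
  (* A nonzero term has [2^(kap i) <= rho], hence [rho^(s-1) <= a^(kap i) <= t i]; the number of
     such [i] is bounded by [tw], and each costs at most 4. *)
  have bh : \sum_(i < M) sqn (mdiff sigma (hi i) (t i) 0 xi) <= 4 * (Cw * rho xi `^ s).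
    apply: (@le_trans _ _ (\sum_(i < M) 4 * (rho xi `^ (s - 1) <= t i)%R%:R)).
      apply: ler_sum => i _; rewrite /mdiff /hi.
      case: ifPn => [/andP[hl ti]|_]; last by rewrite sqn0 mulr_ge0.
      apply: le_trans (sqn_cisB_le4 _ _) _.
      suff -> : rho xi `^ (s - 1) <= t i by rewrite mulr1.
      have [aK _] := hkap i ti; apply: le_trans aK.
      rewrite /a -powR2X -[s - 1]opprB !powRN lef_pV2 ?posrE ?powR_gt0 ?exprn_gt0//; last first.
        exact: lt_le_trans (rho_ge1 xi).
      apply: ge0_ler_powR; rewrite ?nnegrE ?exprn_ge0//.
      - by move: s1; lra.
      - by apply: le_trans (rho_ge1 xi).
      - by move: hl; rewrite /low -leNgt.
    by rewrite -mulr_sumr ler_wpM2l// tw// rho_ge1.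
  rewrite b0; lra.
move=> i iM x.
have [_ _ Ql0 _ _] := dQl.
have [_ _ Qhs0 _ _] := dQhs.
have mT := @measurable_pred_T R N.
have -> : mexp sigma (fun=> true) (t i) = fun xi =>
    mexp sigma (fun=> true) 0 xi + mdiff sigma (fun=> true) (t i) 0 xi.
  by apply/funext => xi; rewrite /mexp /mdiff addrC subrK.
rewrite mulopD//; [|exact: multiplier_mexp|exact: multiplier_mdiff].
apply: le_trans (sqn_addw _ _) _; apply: lerD; first exact: ler_wpM2l.
apply: ler_wpM2l => //.
have := t0 i; rewrite le_eqVlt => /predU1P[<-|ti].
  rewrite (dominated_D_refl ih msigma mT) addr_ge0// mulr_ge0//.
have -> : mdiff sigma (fun=> true) (t i) 0 = fun xi =>
    mdiff sigma (hi i) (t i) 0 xi + mdiff sigma (low (kap i)) (t i) 0 xi.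
  apply/funext => xi; rewrite /mdiff /hi ti andbT.
  by case: (low _ _); rewrite ?addr0 ?add0r.
rewrite mulopD//; [|exact: multiplier_mdiff|(by apply: multiplier_mdiff => //; exact: measurable_pred_low)].
apply: le_trans (sqn_addw _ _) _; apply: lerD; apply: ler_wpM2l => //.
  rewrite (bigD1 (Ordinal iM))//= lerDl sumr_ge0// => p _; exact: sqn_ge0.
apply: Qlb => //.
rewrite /n ltnS.
exact: (leq_bigmax (F := fun i : 'I_M => kap i) (Ordinal iM)).
Qed.

End maximal_estimate.

(** The exponent [r = s / (1 - s)] is the one for which the level [x^(s-1)], raised to the power
    [r], is [x^-s]. *)
Lemma count_weak_lr (R : realType) (s : R) (t : nat -> R) : s < 1 ->
  in_weak_lr (s / (1 - s)) t ->
  exists2 Cw, 0 <= Cw & forall M x, 1 <= x ->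
    \sum_(n < M) (x `^ (s - 1) <= t n)%R%:R <= Cw * x `^ s.
Proof.
move=> s1; rewrite /in_weak_lr; set r := s / (1 - s); set S := ereal_sup _ => Soo.
have SP b : 0 < b -> ((b `^ r)%:E * counting [set n | (b < t n)%R] <= S)%E.
  by move=> b0; apply: ereal_sup_ubound; exists b.
have S0 : (0 <= S)%E.
  by apply: le_trans (SP 1 ltr01); rewrite mule_ge0// lee_fin powR_ge0.
have SE : S = (fine S)%:E by rewrite fineK// ge0_fin_numE.
exists (fine S / 2^-1 `^ r); first by rewrite divr_ge0 ?fine_ge0 ?powR_ge0.
move=> M x x1; have x0 : 0 < x by exact: lt_le_trans x1.
(* Halving the level passes from [<=] to the strict inequality of [in_weak_lr]; it costs only the
   factor [2^r] in the constant. *)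
set b := x `^ (s - 1) * 2^-1.
have b0 : 0 < b by rewrite mulr_gt0// powR_gt0.
have br : b `^ r = (x `^ s)^-1 * 2^-1 `^ r.
  rewrite powRM ?powR_ge0// -powRrM -powRN; congr (_ `^ _ * _).
  by rewrite /r; field; rewrite subr_eq0 gt_eqF.
have c : ((\sum_(n < M) (x `^ (s - 1) <= t n)%R%:R)%:E <=
    counting [set n | (b < t n)%R] :> \bar R)%E.
  rewrite counting_dirac.
  apply: le_trans (nneseries_lim_ge M (m := 0) (P := xpredT) _) => //.
  rewrite big_mkord -sumEFin; apply: lee_sum => n _.
  rewrite diracE lee_fin ler_nat; case: (boolP (x `^ (s - 1) <= t n)) => //= xt.
  rewrite mem_set//=; apply: lt_le_trans xt.
  by rewrite /b gtr_pMr ?powR_gt0// invf_lt1// ltr1n.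
have : ((b `^ r)%:E * (\sum_(n < M) (x `^ (s - 1) <= t n)%R%:R)%:E <= S)%E.
  by apply: le_trans (SP b b0); rewrite lee_wpmul2l// lee_fin powR_ge0.
rewrite SE -EFinM lee_fin br; set c' := \sum_(n < M) _.
have xs0 : 0 < x `^ s by exact: powR_gt0.
have h0 : 0 < 2^-1 `^ r :> R by rewrite powR_gt0// invr_gt0.
by rewrite -mulrA mulrC ler_pdivrMr// mulrC -ler_pdivlMr// mulrAC.
Qed.

(** * [L^2] extensions and truncation *)

Section l2_extension.
Variables (R : realType) (N : nat).
Local Notation Rn := (Rn R N).
Local Notation mu := (lebesgue R N).
Implicit Types (f g : Rn -> R[i]).
Local Open Scope ereal_scope.

Lemma normL2E f : (normL 2 f) `^ 2 = \int[mu]_x (sqn (f x))%:E.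
Proof.
rewrite /normL poweR_Lnorm//; apply: eq_integral => x _.
by rewrite /= powR_mulrn// normc_sqn ger0_norm ?sqrtr_ge0// sqr_sqrtr// sqn_ge0.
Qed.

Lemma inL2_integral f : inL 2 f -> \int[mu]_x (sqn (f x))%:E < +oo.
Proof. by move=> [_ fin]; rewrite -normL2E poweR_lty. Qed.

Lemma inL2_0 : inL 2 (fun _ : Rn => 0%R : R[i]).
Proof.
split; first by split; exact: measurable_cst.
rewrite /normL (_ : (fun _ => _) = cst 0); first by rewrite Lnorm0.
by apply/funext => x; rewrite normc_sqn sqn0 sqrtr0.
Qed.

(** True whether or not an extension exists, since the default value of [xget] is the zero
    function. *)
Lemma inL2_L2extension T f : inL 2 (@L2extension R N T f).
Proof.
rewrite /L2extension; case: xgetP => [g _ []//|_].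
exact: inL2_0.
Qed.

Lemma inL1_cintegrable f : inL 1 f -> cintegrable f.
Proof.
move=> [[mr mi] fin]; have i1 : mu.-integrable setT (fun x => (Normc.normc (f x))%:E).
  apply/integrableP; split.
    apply/measurable_EFinP; under eq_fun do rewrite normc_sqn.
    apply: (measurableT_comp (f := @Num.sqrt R)); last exact: measurable_sqn.
    exact: continuous_measurable_fun (@sqrt_continuous R).
  by move: fin; rewrite /normL Lnorm1.
split.
  apply: le_integrable i1 => //; first exact/measurable_EFinP.
  move=> x _; rewrite lee_fin normc_sqn [leRHS]ger0_norm ?sqrtr_ge0//.
  by rewrite -sqrtr_sqr ler_wsqrtr// /sqn lerDl sqr_ge0.
apply: le_integrable i1 => //; first exact/measurable_EFinP.
move=> x _; rewrite lee_fin normc_sqn [leRHS]ger0_norm ?sqrtr_ge0//.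
by rewrite -sqrtr_sqr ler_wsqrtr// /sqn lerDr sqr_ge0.
Qed.

Lemma normL2_cvg0 (u : nat -> Rn -> R[i]) (e : R) :
  normL 2 (u k) @[k --> \oo] --> 0 -> (0 < e)%R ->
  \forall k \near \oo, \int[mu]_x (sqn (u k x))%:E <= (e ^+ 2)%:E.
Proof.
move=> /fine_cvgP[ufin /cvgr0Pnorm_lt/(_ e) uc] e0.
near=> k; rewrite -normL2E.
have fk : normL 2 (u k) \is a fin_num by near: k.
rewrite -(fineK fk) poweR_EFin lee_fin powR_mulrn; last first.
  by rewrite fine_ge0// Lnorm_ge0.
rewrite ler_sqr ?nnegrE ?(ltW e0)//; last by rewrite fine_ge0// Lnorm_ge0.
apply: le_trans (ler_norm _) _; apply: ltW.
by near: k; exact: uc.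
Unshelve. all: by end_near. Qed.

Lemma le_integral_sqn_add (D : set Rn) f g : measurable D ->
  cmeasurable f -> cmeasurable g ->
  \int[mu]_(x in D) (sqn (f x + g x))%:E <=
  2%:E * (\int[mu]_(x in D) (sqn (f x))%:E + \int[mu]_(x in D) (sqn (g x))%:E).
Proof.
move=> mD mf mg.
have m u : cmeasurable u -> measurable_fun D (fun x : Rn => (sqn (u x))%:E).
  by move=> mu_; apply: measurable_funTS; apply/measurable_EFinP; exact: measurable_sqn.
rewrite -ge0_integralD//; last 4 first.
- by move=> x _; rewrite lee_fin sqn_ge0.
- exact: m.
- by move=> x _; rewrite lee_fin sqn_ge0.
- exact: m.
rewrite -ge0_integralZl_EFin//; last 2 first.
- by move=> x _; rewrite -EFinD lee_fin addr_ge0// sqn_ge0.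
- by apply: emeasurable_funD; exact: m.
apply: ge0_le_integral => //.
- by move=> x _; rewrite lee_fin sqn_ge0.
- by apply: m; exact: cmeasurableD.
- by apply: measurable_funeM; apply: emeasurable_funD; exact: m.
- by move=> x _; rewrite -EFinD -EFinM lee_fin mulrDr sqn_add.
Qed.

Lemma oscillatory_integralE (eps : 'I_N -> bool) (t : R) g :
  oscillatory_integral eps t g = mulop g (mexp (symbol eps) (fun=> true) t).
Proof.
apply/funext => x; rewrite /oscillatory_integral /mulop /adjoint_fourier.
congr cintegral; apply/funext => xi; rewrite mulrA; congr (_ * _)%R.
rewrite /mexp; apply/eqP; rewrite eq_complex /= cosD sinD eqxx/=.
by apply/eqP; ring.
Qed.

Lemma measurable_symbol (eps : 'I_N -> bool) : measurable_fun setT (@symbol R N eps).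
Proof.
apply: measurable_sum => i; apply: measurable_funM => //.
by apply: measurable_funX; exact: measurable_tnth.
Qed.

Lemma symbol_le (eps : 'I_N -> bool) (xi : Rn) : (`|symbol eps xi| <= dotp xi xi)%R.
Proof.
apply: le_trans (ler_norm_sum _ _ _) _; apply: ler_sum => i _.
by rewrite normrM normrX normrN1 expr1n mul1r ger0_norm ?sqr_ge0.
Qed.

Lemma cmeasurableB f g : cmeasurable f -> cmeasurable g ->
  cmeasurable (fun x : Rn => f x - g x)%R.
Proof.
move=> [rf jf] [rg jg]; split.
  rewrite (_ : (fun _ => _) = fun x => complex.Re (f x) - complex.Re (g x))%R.
    exact: measurable_funB.
  by apply/funext => x; case: (f x) (g x) => [? ?] [? ?].
rewrite (_ : (fun _ => _) = fun x => complex.Im (f x) - complex.Im (g x))%R.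
  exact: measurable_funB.
by apply/funext => x; case: (f x) (g x) => [? ?] [? ?].
Qed.

Lemma cintegrableB f g : cintegrable f -> cintegrable g ->
  cintegrable (fun x : Rn => f x - g x)%R.
Proof.
move=> i1 /cintegrableN[r2 j2]; have [r1 j1] := i1; split.
  under eq_fun do rewrite ReD EFinD; exact: integrableD.
by under eq_fun do rewrite ImD EFinD; exact: integrableD.
Qed.

(** [g - T h] is the sum of [g - T u_k], small by the definition of an extension, and [T (u_k - h)],
    controlled on the ball by the local bound. The 4 comes from two uses of [sqn_add]. The estimate
    holds for every version [g], so uniqueness of the extension is never invoked. *)
Lemma L2extension_bound (eps : 'I_N -> bool) (t : R) f g h :
  is_L2extension (oscillatory_integral eps t) f g -> cintegrable h ->
  \int[mu]_(x in @unit_ball R N) (sqn (g x - oscillatory_integral eps t h x))%:E <=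
  (4 * adjoint_const R N)%:E * \int[mu]_x (sqn (f x - h x))%:E.
Proof.
move=> [[mf fL2] [mg gL2] [u [uL ucvg Tucvg]]] ih.
set A := adjoint_const R N; have A_gt0 : (0 < A)%R by exact: adjoint_const_gt0.
have A0 : (0 <= A)%R by exact: ltW.
(* The two approximation errors add up to [(2 + 4 A) e_^2]. The minimum with 1 allows the square to
   be replaced by [e_]. *)
pose e_ (e : R) : R := (Num.min 1 (e / (2 + 4 * A)))%R.
have c0 : (0 < 2 + 4 * A)%R by lra.
apply/lee_addgt0Pr => e e0.
have d0 : (0 < e_ e)%R by rewrite /e_ lt_min ltr01 divr_gt0.
have dle : ((2 + 4 * A) * e_ e ^+ 2 <= e)%R.
  have d1 : (e_ e <= 1)%R by rewrite /e_ ge_min lexx.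
  have d2 : ((2 + 4 * A) * e_ e <= e)%R.
    by rewrite mulrC -ler_pdivlMr// /e_ ge_min lexx orbT.
  apply: le_trans d2; rewrite expr2 mulrA ler_piMr// mulr_ge0 ?ltW//.
have [k [k1 k2]] : exists k,
    \int[mu]_x (sqn (u k x - f x)%R)%:E <= (e_ e ^+ 2)%:E /\
    \int[mu]_x (sqn (oscillatory_integral eps t (u k) x - g x))%:E <= (e_ e ^+ 2)%:E.
  exact: filter_ex (filterI (normL2_cvg0 ucvg d0) (normL2_cvg0 Tucvg d0)).
pose m := mexp (symbol eps) (fun _ : Rn => true) t.
have mT : multiplier m.
  by apply: multiplier_mexp; [exact: measurable_symbol|exact: measurable_pred_T].
have mm := mT.1.
have sm xi : sqn (m xi) = 1%R by rewrite /m /mexp sqn_cis.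
have iu : cintegrable (u k) by apply: inL1_cintegrable; have [] := uL k.
have iv := cintegrableB iu ih.
have imv := cintegrableM mm mT.2 iv.
have muk := cintegrable_measurable iu.
have mh := cintegrable_measurable ih.
have mTu : cmeasurable (oscillatory_integral eps t (u k)).
  by rewrite oscillatory_integralE; exact/cmeasurable_adjoint_fourier/(cintegrableM mm mT.2).
have mTv := cmeasurable_adjoint_fourier imv.
have TuE x : (oscillatory_integral eps t (u k) x - oscillatory_integral eps t h x =
    adjoint_fourier (fun xi => m xi * (u k xi - h xi)) x)%R.
  rewrite !oscillatory_integralE; apply/eqP; rewrite subr_eq; apply/eqP.
  rewrite /mulop -adjoint_fourierD//; last exact: (cintegrableM mm mT.2).
  by congr (adjoint_fourier _ _); apply/funext => xi; rewrite -mulrDr subrK.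
have mB := @measurable_unit_ball R N.
have b1 : \int[mu]_x (sqn (u k x - h x))%:E <=
    2%:E * ((e_ e ^+ 2)%:E + \int[mu]_x (sqn (f x - h x))%:E).
  have := @le_integral_sqn_add setT (fun x => u k x - f x)%R (fun x => f x - h x)%R
    measurableT (cmeasurableB muk mf) (cmeasurableB mf mh).
  under [X in X <= _ -> _]eq_integral do rewrite addrA subrK.
  by move/le_trans; apply; rewrite lee_wpmul2l ?lee_fin// leeD2r.
have b2 : \int[mu]_(x in @unit_ball R N)
      (sqn (adjoint_fourier (fun xi => m xi * (u k xi - h xi))%R x))%:E <=
    A%:E * \int[mu]_x (sqn (u k x - h x))%:E.
  apply: le_trans (adjoint_fourier_bound imv) _.
  by under eq_integral do rewrite sqnM sm mul1r.
have b3 : \int[mu]_(x in @unit_ball R N) (sqn (g x - oscillatory_integral eps t (u k) x))%:E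
    <= (e_ e ^+ 2)%:E.
  apply: le_trans k2; under [X in _ <= X]eq_integral do rewrite -sqnN opprB.
  apply: ge0_subset_integral => //.
    by apply/measurable_EFinP; apply: measurable_sqn; exact: cmeasurableB.
  by move=> x _; rewrite lee_fin sqn_ge0.
have := @le_integral_sqn_add (@unit_ball R N)
  (fun x => g x - oscillatory_integral eps t (u k) x)%R _ mB (cmeasurableB mg mTu) mTv.
under [X in X <= _ -> _]eq_integral do rewrite -TuE addrA subrK.
move/le_trans; apply.
have I0 : 0 <= \int[mu]_x (sqn (f x - h x))%:E.
  by apply: integral_ge0 => x _; rewrite lee_fin sqn_ge0.
apply: (@le_trans _ _ (2%:E * ((e_ e ^+ 2)%:E +
    A%:E * (2%:E * ((e_ e ^+ 2)%:E + \int[mu]_x (sqn (f x - h x))%:E))))).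
  rewrite lee_wpmul2l ?lee_fin// leeD// (le_trans b2)// lee_wpmul2l ?lee_fin//.
have e20 : 0 <= (e_ e ^+ 2)%:E by rewrite lee_fin sqr_ge0.
case: (\int[mu]_x _) I0 => [I||]// I0.
  by do ![rewrite -EFinD|rewrite -EFinM]; rewrite lee_fin; move: dle; lra.
have -> : (4 * A)%:E * +oo = +oo by rewrite gt0_muley// lte_fin mulr_gt0.
by rewrite addye// leey.
Qed.

End l2_extension.

(** * Truncation to bounded frequencies *)

Section truncation.
Variables (R : realType) (N : nat).
Local Notation Rn := (Rn R N).
Local Notation mu := (lebesgue R N).
Variable f : Rn -> R[i].
Hypothesis fL2 : inL 2 f.

Definition frequency_trunc (j : nat) (xi : Rn) : R[i] := if low j xi then f xi else 0.

Let mf : cmeasurable f. Proof. by have [] := fL2. Qed.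

Lemma lebesgue_low_lty j : (mu [set xi | low j xi] < +oo)%E.
Proof.
apply: le_lt_trans (@lebesgue_cube_lty R N (2 ^+ j)).
apply: le_measure; rewrite ?inE.
- exact: measurable_pred_low.
- exact: measurable_cube.
move=> x /=; rewrite /low /rho => lx i /=; rewrite in_itv/=.
have : tnth x i ^+ 2 <= dotp x x.
  rewrite /dotp (bigD1 i)//= expr2 lerDl sumr_ge0// => k _; exact: sqr_ge0.
have : 1 <= 2 ^+ j :> R by rewrite exprn_ege1// ler1n.
by rewrite -ler_norml => j1 x2; rewrite ler_norml; apply/andP; split; nra.
Qed.

Let low_indic j : Rn -> R := fun xi => (low j xi)%:R.

Let ilow j : mu.-integrable setT (EFin \o low_indic j).
Proof.
have mj := @measurable_pred_low R N j.
rewrite (_ : EFin \o _ = fun xi => (\1_([set xi | low j xi]) xi)%:E).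
  apply/integrableP; split.
    exact/measurable_EFinP.
  rewrite (eq_integral (fun xi => (\1_([set xi | low j xi]) xi)%:E)).
    by rewrite integral_indic// setIT lebesgue_low_lty.
  by move=> x _; rewrite gee0_abs// lee_fin.
apply/funext => xi /=; rewrite /low_indic indicE.
by case: (boolP (low j xi)) => l; [rewrite mem_set|rewrite memNset//; exact/negP].
Qed.

Let isqn : mu.-integrable setT (fun xi => (sqn (f xi))%:E).
Proof.
apply/integrableP; split; first by apply/measurable_EFinP; exact: measurable_sqn.
under eq_integral do rewrite gee0_abs ?lee_fin ?sqn_ge0//.
exact: inL2_integral.
Qed.

Lemma cmeasurable_trunc j : cmeasurable (frequency_trunc j).
Proof.
have mj := measurable_fun_pred (@measurable_pred_low R N j); have [rf jf] := mf; split.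
  rewrite (_ : (fun _ => _) = fun x => if low j x then complex.Re (f x) else 0).
    exact: measurable_fun_ifT.
  by apply/funext => x; rewrite /frequency_trunc; case: low.
rewrite (_ : (fun _ => _) = fun x => if low j x then complex.Im (f x) else 0).
  exact: measurable_fun_ifT.
by apply/funext => x; rewrite /frequency_trunc; case: low.
Qed.

(** Square-integrable functions are integrable on sets of finite measure: [|x| <= 1 + |z|^2] for a
    component [x] of [z] does the work of Cauchy-Schwarz. *)
Lemma cintegrable_trunc j : cintegrable (frequency_trunc j).
Proof.
have id := integrableD measurableT (ilow j) isqn.
have [mr mi] := cmeasurable_trunc j.
have b (x y : R) : `|x| <= 1 + (x ^+ 2 + y ^+ 2).
  have := sqr_ge0 (`|x| - 1); have := sqr_ge0 y.
  by rewrite -(real_normK (num_real x)); nra.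
split; apply: le_integrable id => //; try exact/measurable_EFinP.
  move=> x _; rewrite [leRHS]gee0_abs; last by rewrite -EFinD lee_fin addr_ge0// sqn_ge0.
  rewrite -EFinD lee_fin /frequency_trunc /low_indic.
  by case: low => /=; [exact: b|rewrite normr0 add0r sqn_ge0].
move=> x _; rewrite [leRHS]gee0_abs; last by rewrite -EFinD lee_fin addr_ge0// sqn_ge0.
rewrite -EFinD lee_fin /frequency_trunc /low_indic.
by case: low => /=; [rewrite /sqn [X in 1 + X]addrC; exact: b|rewrite normr0 add0r sqn_ge0].
Qed.

Lemma trunc_cvg :
  (\int[mu]_xi (sqn (f xi - frequency_trunc j xi))%:E @[j --> \oo] --> 0)%E.
Proof.
have md j : measurable_fun setT (fun xi => (sqn (f xi - frequency_trunc j xi))%:E).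
  apply/measurable_EFinP; apply: measurable_sqn; apply: cmeasurableB => //.
  exact: cmeasurable_trunc.
have := @dominated_convergence _ _ _ mu setT measurableT
  (fun j xi => (sqn (f xi - frequency_trunc j xi))%:E) (cst 0%E) _ md
  (measurable_cst _) _ isqn _.
case.
- apply: aeW => xi _; apply: cvg_near_cst; near=> j.
  rewrite /frequency_trunc (_ : low j xi = true) ?subrr ?sqn0//.
  rewrite /low.
  apply: (@lt_le_trans _ _ (Num.truncn (rho xi)).+1%:R); first exact: truncnS_gt.
  have jn : ((Num.truncn (rho xi)).+1 <= j)%N by near: j; exact: nbhs_infty_ge.
  by rewrite -natrX ler_nat (leq_trans jn)// ltnW// ltn_expl.
- apply: aeW => xi j _; rewrite gee0_abs ?lee_fin ?sqn_ge0//.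
  rewrite /frequency_trunc; case: low; last by rewrite subr0.
  by rewrite subrr sqn0 sqn_ge0.
by move=> _ _; rewrite integral0.
Unshelve. all: by end_near. Qed.

End truncation.

(** * Finitely many times, with [f] in [L^2] on the frequency side *)

Section maximal_finite.
Variables (R : realType) (N : nat) (eps : 'I_N -> bool) (s : R) (t : nat -> R) (Cw : R).
Local Notation Rn := (Rn R N).
Local Notation mu := (lebesgue R N).
Hypotheses (s0 : 0 < s) (s1 : s < 1 / 2).
Hypothesis t0 : forall n, 0 <= t n.
Hypothesis Cw0 : 0 <= Cw.
Hypothesis tw : forall M x, 1 <= x ->
  \sum_(n < M) (x `^ (s - 1) <= t n)%R%:R <= Cw * x `^ s.
Variables (f : Rn -> R[i]) (g : nat -> Rn -> R[i]).
Hypothesis fL2 : inL 2 f.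
Hypothesis gP : forall n,
  is_L2extension (oscillatory_integral eps (t n)) f (g n) \/ g n = fun=> 0.
Hypothesis mg : forall n, cmeasurable (g n).

Let A := adjoint_const R N.
Let Cm := maximal_const s Cw.
Let mB := @measurable_unit_ball R N.

Fixpoint maxn_sqn M (x : Rn) : R :=
  if M is M'.+1 then Num.max (maxn_sqn M' x) (sqn (g M' x)) else 0.

Lemma maxn_sqn_ge0 M x : 0 <= maxn_sqn M x.
Proof. by elim: M => //= M IH; rewrite le_max IH. Qed.

Lemma maxn_sqn_le M x c : 0 <= c -> (forall n, (n < M)%N -> sqn (g n x) <= c) ->
  maxn_sqn M x <= c.
Proof.
move=> c0; elim: M => //= M IH gc; rewrite ge_max gc// andbT.
by apply: IH => n nM; apply: gc; exact: ltnW.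
Qed.

Lemma measurable_maxn_sqn M : measurable_fun setT (maxn_sqn M).
Proof.
elim: M => [|M IH] //=; apply: measurable_maxr => //.
exact: measurable_sqn.
Qed.

Local Open Scope ereal_scope.

(** The truncation error is set to 0 when [g n] is no extension: by [gP] it is then the zero
    function, which needs no approximation. *)
Let err j n (x : Rn) : R := if `[< is_L2extension (oscillatory_integral eps (t n)) f (g n) >]
  then sqn (g n x - oscillatory_integral eps (t n) (frequency_trunc f j) x)%R else 0%R.

Let cmosc n h : cintegrable h -> cmeasurable (oscillatory_integral eps (t n) h).
Proof.
move=> ih; rewrite oscillatory_integralE; apply: cmeasurable_adjoint_fourier.
have [mm bm] := multiplier_mexp (@measurable_symbol R N eps) (t n) (@measurable_pred_T R N).
exact: cintegrableM.
Qed.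

Let err0 j n x : (0 <= err j n x)%R.
Proof. by rewrite /err; case: ifPn => // _; exact: sqn_ge0. Qed.

Let merr j n : measurable_fun setT (err j n).
Proof.
rewrite /err; case: asboolP => // _; apply: measurable_sqn.
by apply: cmeasurableB => //; apply: cmosc; exact: cintegrable_trunc.
Qed.

Let err_le j n : \int[mu]_(x in @unit_ball R N) (err j n x)%:E <=
  (4 * A)%:E * \int[mu]_xi (sqn (f xi - frequency_trunc f j xi)%R)%:E.
Proof.
rewrite /err; case: asboolP => [e|_].
  by apply: L2extension_bound => //; exact: cintegrable_trunc.
rewrite integral0 mule_ge0//.
  by rewrite lee_fin mulr_ge0// ltW// adjoint_const_gt0.
by apply: integral_ge0 => x _; rewrite lee_fin sqn_ge0.
Qed.

(** [maximal_dominated] is applied to the truncations of [f], and the [M] truncation errors are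
    summed crudely. Their constant [K] grows with [M], but [M] is fixed while [j] tends to infinity,
    so the final constant does not depend on it. *)
Lemma integral_maxn_sqn M :
  \int[mu]_(x in @unit_ball R N) (maxn_sqn M x)%:E <=
  (2 * A * Cm)%:E * \int[mu]_xi (rho xi `^ s * sqn (f xi))%:E.
Proof.
pose I j := \int[mu]_xi (sqn (f xi - frequency_trunc f j xi)%R)%:E.
pose K : R := (2 * (M%:R * (4 * A)))%R.
have mf : cmeasurable f by case: fL2.
have Cm0 : (0 <= Cm)%R by exact: maximal_const_ge0.
have A0 : (0 <= A)%R by rewrite ltW// adjoint_const_gt0.
have mrs : measurable_fun setT (fun xi : Rn => rho xi `^ s)%R.
  apply: (measurableT_comp (f := @powR R ^~ s)); first exact: measurable_powR.
  exact: measurable_rho.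
have step j : \int[mu]_(x in @unit_ball R N) (maxn_sqn M x)%:E <=
    (2 * A * Cm)%:E * \int[mu]_xi (rho xi `^ s * sqn (f xi))%:E + K%:E * I j.
  have ih := cintegrable_trunc fL2 j.
  have [Q dQ Qb] := maximal_dominated (@measurable_symbol R N eps) (@symbol_le R N eps)
    s0 s1 t0 tw ih M.
  have [mQ mW Q0 W0 bQ] := dQ.
  have pt x : (maxn_sqn M x <= 2 * Q x + 2 * \sum_(n < M) err j n x)%R.
    have S0 : (0 <= \sum_(n < M) err j n x)%R by apply: sumr_ge0.
    apply: maxn_sqn_le => [|n nM]; first by rewrite addr_ge0 ?mulr_ge0.
    have [e|->] := gP n; last by rewrite sqn0 addr_ge0 ?mulr_ge0.
    rewrite -[g n x](subrK (oscillatory_integral eps (t n) (frequency_trunc f j) x)) addrC.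
    apply: le_trans (sqn_add _ _) _; apply: lerD; rewrite ler_wpM2l//.
      by rewrite oscillatory_integralE; exact: Qb.
    rewrite (bigD1 (Ordinal nM))//= [X in (_ <= X + _)%R]/err asboolT// lerDl.
    by apply: sumr_ge0.
  have mS : measurable_fun setT (fun x => \sum_(n < M) err j n x)%R.
    exact: measurable_sum.
  apply: (@le_trans _ _ (\int[mu]_(x in @unit_ball R N)
      (2%:E * (Q x)%:E + 2%:E * (\sum_(n < M) err j n x)%:E))).
    apply: ge0_le_integral => //.
    - by move=> x _; rewrite lee_fin maxn_sqn_ge0.
    - by apply: measurable_funTS; apply/measurable_EFinP; exact: measurable_maxn_sqn.
    - apply: measurable_funTS; apply: emeasurable_funD; apply: measurable_funeM;
        exact/measurable_EFinP.
    - by move=> x _; rewrite -!EFinM -EFinD lee_fin.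
  have S0 x : (0 <= \sum_(n < M) err j n x)%R by apply: sumr_ge0.
  rewrite ge0_integralD//; last 4 first.
  - by move=> x _; rewrite -EFinM lee_fin mulr_ge0.
  - by apply: measurable_funTS; apply: measurable_funeM; exact/measurable_EFinP.
  - by move=> x _; rewrite -EFinM lee_fin mulr_ge0.
  - by apply: measurable_funTS; apply: measurable_funeM; exact/measurable_EFinP.
  rewrite !ge0_integralZl_EFin//; last 4 first.
  - by move=> x _; rewrite lee_fin.
  - by apply: measurable_funTS; exact/measurable_EFinP.
  - by move=> x _; rewrite lee_fin.
  - by apply: measurable_funTS; exact/measurable_EFinP.
  apply: leeD.
    rewrite -mulrA EFinM -muleA lee_wpmul2l ?lee_fin// (le_trans bQ)//.
    rewrite [(A * Cm)%:E]EFinM -muleA lee_wpmul2l ?lee_fin//.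
    rewrite -ge0_integralZl_EFin//; last 2 first.
    - by move=> x _; rewrite lee_fin mulr_ge0 ?powR_ge0 ?sqn_ge0.
    - by apply/measurable_EFinP/measurable_funM => //; exact: measurable_sqn.
    apply: ge0_le_integral => //.
    - by move=> x _; rewrite lee_fin mulr_ge0 ?sqn_ge0.
    - apply/measurable_EFinP/measurable_funM => //.
      by apply: measurable_sqn; exact: cmeasurable_trunc.
    - apply: measurable_funeM; apply/measurable_EFinP/measurable_funM => //.
      exact: measurable_sqn.
    - move=> x _; rewrite -EFinM lee_fin mulrA ler_wpM2l//.
      by rewrite /frequency_trunc; case: low => //; rewrite sqn0 sqn_ge0.
  rewrite /K EFinM -muleA lee_wpmul2l ?lee_fin//.
  under eq_integral do rewrite -sumEFin.
  rewrite ge0_integral_sum//; last 2 first.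
  - by move=> n; apply: measurable_funTS; exact/measurable_EFinP.
  - by move=> n x _; rewrite lee_fin.
  apply: (@le_trans _ _ (\sum_(n < M) ((4 * A)%:E * I j))%E).
    by apply: lee_sum => n _; exact: err_le.
  rewrite [(M%:R * (4 * A))%:E]EFinM -muleA -/(I j).
  have I0 : 0 <= (4 * A)%:E * I j.
    apply: mule_ge0; first by rewrite lee_fin mulr_ge0.
    by rewrite /I; apply: integral_ge0 => x _; rewrite lee_fin sqn_ge0.
  have key (z : \bar R) n : 0 <= z -> \sum_(i < n) z <= (n%:R)%:E * z.
    move=> z0; elim: n => [|n IH].
      by rewrite big_ord0 mul0e.
    rewrite big_ord_recr/= -natr1 EFinD ge0_muleDl ?lee_fin// mul1e.
    exact: leeD.
  exact: key.
have /fine_cvgP[Ifin /cvgr0Pnorm_lt Icvg] := trunc_cvg fL2.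
have K0 : (0 <= K)%R by do 3 rewrite mulr_ge0//.
apply/lee_addgt0Pr => e e0.
have e1 : (0 < e / (K + 1))%R by rewrite divr_gt0// ltr_wpDl.
have [j [/= fj Ij]] := filter_ex (filterI Ifin (Icvg _ e1)).
apply: le_trans (step j) _; rewrite leeD2l//.
rewrite -[I j](fineK fj) -EFinM lee_fin.
apply: le_trans (_ : K * (e / (K + 1)) <= _)%R.
  by rewrite ler_wpM2l// (le_trans (ler_norm _))// ltW.
rewrite mulrCA ler_piMr ?(ltW e0)// ler_pdivrMr ?mul1r ?lerDl//.
by rewrite ltr_wpDl.
Qed.

End maximal_finite.

Lemma measurable_ereal_sup_range d (T : measurableType d) (R : realType)
    (u : nat -> T -> \bar R) : (forall n, measurable_fun setT (u n)) ->
  measurable_fun setT (fun x => ereal_sup (range (u ^~ x))).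
Proof.
move=> mu; rewrite (_ : (fun x => _) = fun x => esups (u ^~ x) 0).
  exact: measurable_fun_esups.
apply/funext => x; rewrite /esups /sdrop; congr ereal_sup.
by apply/seteqP; split=> _ [n /= _ <-]; exists n.
Qed.

(** * From finitely many times to the full supremum *)

Section maximal_function_bound.
Variables (R : realType) (N : nat) (eps : 'I_N -> bool) (s : R) (t : nat -> R) (Cw : R).
Local Notation Rn := (Rn R N).
Local Notation mu := (lebesgue R N).
Hypotheses (s0 : 0 < s) (s1 : s < 1 / 2).
Hypothesis t0 : forall n, 0 <= t n.
Hypothesis Cw0 : 0 <= Cw.
Hypothesis tw : forall M x, 1 <= x ->
  \sum_(n < M) (x `^ (s - 1) <= t n)%R%:R <= Cw * x `^ s.
Variable f : Rn -> R[i].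

Let g n := propagator eps (t n) f.
Let mf := maximal_function g.
Let C2 : R := 2 * adjoint_const R N * maximal_const s Cw.

Local Open Scope ereal_scope.

Let mg n : cmeasurable (g n).
Proof. by have [] := inL2_L2extension (oscillatory_integral eps (t n)) (fourier f). Qed.

Let gP n : is_L2extension (oscillatory_integral eps (t n)) (fourier f) (g n) \/
  g n = fun=> 0%R.
Proof.
by rewrite /g /propagator /L2extension; case: xgetP => [u _ ?|_]; [left|right].
Qed.

Let mf0 x : 0 <= mf x.
Proof.
apply: le_trans (ereal_sup_ubound _); last by exists 0%N.
by rewrite lee_fin normc_sqn sqrtr_ge0.
Qed.

Let mmf : measurable_fun setT mf.
Proof.
apply: (@measurable_ereal_sup_range _ _ _ (fun n x => (Normc.normc (g n x))%:E)) => n.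
apply/measurable_EFinP; under eq_fun do rewrite normc_sqn.
apply: (measurableT_comp (f := @Num.sqrt R)); last exact: measurable_sqn.
exact: continuous_measurable_fun (@sqrt_continuous R).
Qed.

Let G M (x : Rn) : \bar R := (maxn_sqn g M x)%:E.

Let ndG x : nondecreasing_seq (G ^~ x).
Proof.
apply/nondecreasing_seqP => M; rewrite lee_fin /=.
by rewrite le_max lexx.
Qed.

Let mG M : measurable_fun setT (G M).
Proof. by apply/measurable_EFinP; exact: measurable_maxn_sqn. Qed.

Let L x := ereal_sup (range (G ^~ x)).

(** Squaring has to be moved inside the supremum; each single modulus is compared with the square
    root of [L] instead. *)
Let mf_le x : mf x `^ 2 <= L x.
Proof.
have L0 : 0 <= L x.
  apply: le_trans (ereal_sup_ubound _); last by exists 0%N.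
  by rewrite lee_fin maxn_sqn_ge0.
have le2 : mf x <= L x `^ 2^-1.
  apply: ge_ereal_sup => _ [n _ <-].
  rewrite normc_sqn -powR12_sqrt ?sqn_ge0// -poweR_EFin.
  apply: gt0_ler_poweR.
  - by rewrite invr_ge0.
  - by rewrite in_itv/= leey lee_fin sqn_ge0.
  - by rewrite in_itv/= leey L0.
  apply: le_trans (ereal_sup_ubound _); last by exists n.+1.
  by rewrite lee_fin /= le_max lexx orbT.
rewrite -[leRHS]poweRe1// -[in leRHS](@mulVf _ 2%R)// poweRrM.
apply: gt0_ler_poweR => //.
- by rewrite in_itv/= leey mf0.
- by rewrite in_itv/= leey poweR_ge0.
Qed.

(** Monotone convergence applies because the bound in [integral_maxn_sqn] is uniform in [M]. *)
Let integral_mf : \int[mu]_(x in @unit_ball R N) mf x `^ 2 <=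
  C2%:E * \int[mu]_xi (rho xi `^ s * sqn (fourier f xi))%:E.
Proof.
have mB := @measurable_unit_ball R N.
apply: (@le_trans _ _ (\int[mu]_(x in @unit_ball R N) L x)).
  apply: ge0_le_integral => //.
  - by move=> x _; exact: poweR_ge0.
  - apply: measurable_funTS.
    exact: (measurableT_comp (measurable_poweR _) mmf).
  - by apply: measurable_funTS; exact: measurable_ereal_sup_range.
rewrite (eq_integral (fun x => limn (G ^~ x))); last first.
  by move=> x _; apply/esym/cvg_lim => //; exact: ereal_nondecreasing_cvgn.
have mGB M : measurable_fun (@unit_ball R N) (G M) by exact: measurable_funTS.
have G0 M x : (@unit_ball R N) x -> 0 <= G M x by rewrite lee_fin maxn_sqn_ge0.
have ndGB x : (@unit_ball R N) x -> nondecreasing_seq (G ^~ x) by move=> _; exact: ndG.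
rewrite (monotone_convergence _ mB mGB G0 ndGB).
apply: lime_le.
  apply: ereal_nondecreasing_is_cvgn => m n mn.
  by apply: ge0_le_integral => // x Bx; [exact: G0|exact: ndGB].
by apply: nearW => M; apply: integral_maxn_sqn gP mg M => //; exact: inL2_L2extension.
Qed.

Lemma sobolev_normE : sobolev_norm s f =
  (\int[mu]_xi (rho xi `^ s * sqn (fourier f xi))%:E) `^ 2^-1.
Proof.
rewrite -[LHS]poweRe1; last exact: Lnorm_ge0.
rewrite -[X in _ `^ X](@mulfV _ 2%R)// poweRrM normL2E; congr (_ `^ _).
apply: eq_integral => xi _; rewrite sqnM; congr (_ * _)%:E.
rewrite /sqn /= expr0n/= addr0 -powR_mulrn ?powR_ge0// -powRrM divfK//.
Qed.

Lemma maximal_function_bound :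
  Lnorm mu 2%:E (mf \_ (@unit_ball R N)) <= (C2 `^ 2^-1)%:E * sobolev_norm s f.
Proof.
have C20 : (0 <= C2)%R.
  by rewrite /C2 mulr_ge0 ?maximal_const_ge0// mulr_ge0// adjoint_const_ge0.
have Y0 : 0 <= \int[mu]_xi (rho xi `^ s * sqn (fourier f xi))%:E.
  by apply: integral_ge0 => xi _; rewrite lee_fin mulr_ge0 ?powR_ge0 ?sqn_ge0.
rewrite sobolev_normE -poweR_EFin -poweRM ?lee_fin// unlock /Lnorm.
have -> : \int[mu]_x `|(mf \_ (@unit_ball R N)) x| `^ 2 =
    \int[mu]_(x in @unit_ball R N) mf x `^ 2.
  rewrite [RHS]integral_mkcond; apply: eq_integral => x _; rewrite !patchE.
  case: ifPn => _; first by rewrite gee0_abs.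
  by rewrite abse0 poweR0r.
apply: gt0_ler_poweR; rewrite ?invr_ge0// in_itv/= leey andbT.
  by apply: integral_ge0 => x _; exact: poweR_ge0.
by rewrite mule_ge0.
Qed.

End maximal_function_bound.

Theorem theorem1p11 (R : realType) (N : nat) (eps : 'I_N -> bool) (s : R)
    (t : nat -> R) (hN : (2 <= N)%N) (hs0 : 0 < s) (hs1 : s < 1 / 2)
    (tdecr : nonincreasing_seq t) (tcvg : t @ \oo --> 0)
    (tweak : in_weak_lr (s / (1 - s)) t) :
  exists C : R, forall f : Rn R N -> R[i], in_sobolev s f ->
    (Lnorm (lebesgue R N) 2%:E
       (maximal_function (fun n => propagator eps (t n) f) \_ (@unit_ball R N))
     <= C%:E * sobolev_norm s f)%E.
Proof.
have [|Cw Cw0 tw] := count_weak_lr _ tweak; first by lra.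
have t0 n : 0 <= t n.
  have := nonincreasing_cvgn_ge tdecr (cvgP _ tcvg) n.
  by rewrite (cvg_lim _ tcvg).
eexists => f _; exact: (maximal_function_bound eps hs0 hs1 t0 Cw0 tw f).
Qed.
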